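(* Let $G$ be a simple graph on the vertex set $\{1,\ldots,n\}$ and let $C=(\{p_{1},p_{2}\},\{p_{2},p_{3}\},\ldots,\{p_{k},p_{1}\})$ be an odd cycle of $G$ of length $k\geq 3$. Consider the prism $C^{\star}$ of $C$ on the vertex set $\{p_{1},\ldots,p_{k},q_{1},\ldots,q_{k}\}$, where $\{p_{1},\ldots,p_{k}\}\cap\{q_{1},\ldots,q_{k}\}=\emptyset$, and let $C'$ be the odd cycle $C'=(\{q_{1},q_{2}\},\{q_{2},q_{3}\},\ldots,\{q_{k-1},q_{k}\},\{q_{k},q_{1}\})$. Then a binomial $B\in P_{C}$ belongs to the universal Gröbner basis of $P_{C}$ if and only if $B=B_{\Gamma}$, where $\Gamma$ is one of the following even closed walks of $C^{\star}$: (1) $\Gamma$ is an even cycle of $C^{\star}$; (2) $\Gamma=(C,\{p_{i},q_{i}\},C')$ where $1\leq i\leq k$.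
   Context: $K$ is a field. A simple graph is a finite undirected graph without loops or multiple edges. $P_C$ is the ideal of the polynomial ring $K[\{x_{ab},x_{ba} : \{a,b\}\in E(C)\}\cup\{x_{aa}\}_{1\le a\le n}]$ generated by the binomials $f_{ab}=x_{aa}x_{bb}-x_{ab}x_{ba}$, $a<b$, $\{a,b\}\in E(C)$. The universal Gröbner basis of an ideal generated by binomials is the union of all its reduced Gröbner bases (over all term orders); binomials are identified up to sign. The prism $C^\star$ has vertices $p_1,\ldots,p_k,q_1,\ldots,q_k$ and $3k$ edges: the edges of $C$, the edges of $C'$, and the edges $\{p_i,q_i\}$, $1\le i\le k$. Its edges are identified with variables as follows: $\{p_i,q_i\}\leftrightarrow x_{p_ip_i}$; and for every edge $\{p_i,p_j\}$ of $C$ with $p_i<p_j$, $\{p_i,p_j\}\leftrightarrow x_{p_ip_j}$ and $\{q_i,q_j\}\leftrightarrow x_{p_jp_i}$. A cycle of length $l\ge3$ is a closed walk $(\{u_1,u_2\},\ldots,\{u_l,u_1\})$ with $u_1,\ldots,u_l$ distinct; it is even (odd) if $l$ is even (odd). For an even closed walk $\Gamma=(g_1,\ldots,g_{2l})$ of $C^\star$, with $x(g)$ denoting the variable corresponding to the edge $g$, $B_\Gamma=\prod_{j=1}^{l}x(g_{2j-1})-\prod_{j=1}^{l}x(g_{2j})$ (repeated edges counted with multiplicity). The notation $\Gamma=(C,\{p_i,q_i\},C')$ means the even closed walk of length $2k+2$ that starts at $p_i$, goes once around $C$ back to $p_i$, crosses the edge $\{p_i,q_i\}$, goes once around $C'$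 from $q_i$ back to $q_i$, and returns to $p_i$ along $\{p_i,q_i\}$. *)

(* Defs.v *)
From mathcomp Require Import all_boot all_order all_algebra.
From mathcomp Require Export mpoly.

Set Implicit Arguments.
Unset Strict Implicit.
Unset Printing Implicit Defensive.

Import GRing.Theory.
Local Open Scope ring_scope.

Section Ideals.
Variable R : comNzRingType.

Definition in_ideal_gen (S : R -> Prop) (f : R) : Prop :=
  exists s : seq (R * R),
    (forall c, c \in s -> S c.2) /\ f = \sum_(c <- s) c.1 * c.2.

End Ideals.

Section Groebner.
Variables (K : fieldType) (m : nat).

Definition term_order (le : rel 'X_{1..m}) : Prop :=
  [/\ antisymmetric le, transitive le, total le,
      forall u, le 0%MM u
    & forall w u v, le u v -> le (u + w)%MM (v + w)%MM].

Definition leading (le : rel 'X_{1..m}) (f : {mpoly K[m]}) (u : 'X_{1..m}) :=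
  u \in msupp f /\ forall v, v \in msupp f -> le v u.

Definition in_initial_ideal (le : rel 'X_{1..m}) (S : {mpoly K[m]} -> Prop) :=
  in_ideal_gen (fun h : {mpoly K[m]} =>
    exists f u, [/\ S f, leading le f u & h = 'X_[u]]).

Definition groebner_basis (le : rel 'X_{1..m}) (I : {mpoly K[m]} -> Prop)
    (s : seq {mpoly K[m]}) : Prop :=
  (forall g, g \in s -> I g) /\
  (forall h, in_initial_ideal le I h <->
             in_initial_ideal le (fun g => g \in s) h).

Definition reduced_groebner_basis (le : rel 'X_{1..m})
    (I : {mpoly K[m]} -> Prop) (s : seq {mpoly K[m]}) : Prop :=
  [/\ groebner_basis le I s,
      forall g, g \in s -> exists2 u, leading le g u & g@_u = 1
    & forall g g' u v, g \in s -> g' \in s -> g != g' ->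
        leading le g u -> v \in msupp g' -> ~~ (u <= v)%MM].

Definition universal_groebner_basis (I : {mpoly K[m]} -> Prop)
    (f : {mpoly K[m]}) : Prop :=
  exists le s,
    [/\ term_order le, reduced_groebner_basis le I s & f \in s].

(* Nonzero coefficients are arbitrary: differences of two distinct monomials
   are a special case. *)
Definition binomial_poly (f : {mpoly K[m]}) : bool := size (msupp f) == 2.

Definition up_to_sign (S : {mpoly K[m]} -> Prop) (f : {mpoly K[m]}) : Prop :=
  S f \/ S (- f).

End Groebner.

Definition simple_graph (T : finType) (e : rel T) : Prop :=
  ssrbool.symmetric e /\ irreflexive e.

(* The cycle ({p_1,p_2}, ..., {p_k,p_1}) is given by its vertices
   p : 'I_k -> T; ordS is the cyclic successor on 'I_k. *)
Definition graph_cycle (T : finType) (e : rel T) (k : nat) (p : 'I_k -> T) :=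
  [/\ (3 <= k)%N, injective p & forall i, e (p i) (p (ordS i))].

Section CycleIdeal.
Variables (K : fieldType) (n k : nat) (p : 'I_k -> 'I_n).

Definition cycle_edge (a b : 'I_n) : bool :=
  [exists i, ((a, b) == (p i, p (ordS i))) || ((b, a) == (p i, p (ordS i)))].

Definition is_cycle_var (ab : 'I_n * 'I_n) : bool :=
  (ab.1 == ab.2) || cycle_edge ab.1 ab.2.

(* One variable x_aa for every a : 'I_n, including those outside the cycle. *)
Definition cycle_var : finType := {ab : 'I_n * 'I_n | is_cycle_var ab}.

(* The value 0 at the index pairs that carry no variable is never used. *)
Definition xvar (ab : 'I_n * 'I_n) : {mpoly K[#|{: cycle_var}|]} :=
  if insub ab is Some v then 'X_(enum_rank (v : cycle_var)) else 0.

Definition edge_binomial (a b : 'I_n) : {mpoly K[#|{: cycle_var}|]} :=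
  xvar (a, a) * xvar (b, b) - xvar (a, b) * xvar (b, a).

Definition in_cycle_ideal : {mpoly K[#|{: cycle_var}|]} -> Prop :=
  in_ideal_gen (fun f => exists a b : 'I_n,
    [/\ (a < b)%N, cycle_edge a b & f = edge_binomial a b]).

(* inl i stands for p_i and inr i for q_i. *)
Definition prism_vertex : finType := ('I_k + 'I_k)%type.

Definition prism_edge (u v : prism_vertex) : bool :=
  match u, v with
  | inl i, inl j | inr i, inr j => (j == ordS i) || (i == ordS j)
  | inl i, inr j | inr i, inl j => i == j
  end.

Definition prism_edge_index (u v : prism_vertex) : 'I_n * 'I_n :=
  match u, v with
  | inl i, inl j => if (p i < p j)%N then (p i, p j) else (p j, p i)
  | inr i, inr j => if (p i < p j)%N then (p j, p i) else (p i, p j)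
  | inl i, inr _ | inr i, inl _ => (p i, p i)
  end.

Lemma prism_edge_index_sym u v :
  injective p -> prism_edge u v -> prism_edge_index u v = prism_edge_index v u.
Proof.
move=> p_inj; case: u v => [i|i] [j|j] //=; try by move/eqP->.
all: by case: ltngtP => // /val_inj/p_inj ->.
Qed.

Lemma prism_edge_index_var u v :
  prism_edge u v -> is_cycle_var (prism_edge_index u v).
Proof.
rewrite /is_cycle_var; case: u v => [i|i] [j|j] /=; rewrite ?eqxx //.
all: move=> e_ij; apply/orP; right; case: ifP => _ /=.
all: case/orP: e_ij => /eqP->; apply/existsP.
all: by [exists i; rewrite eqxx ?orbT | exists j; rewrite eqxx ?orbT].
Qed.

(* A closed walk ({u_1,u_2}, ..., {u_l,u_1}) is encoded by [:: u_1; ...; u_l]. *)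
Definition closed_walk (w : seq prism_vertex) : bool := cycle prism_edge w.

Definition walk_vars (w : seq prism_vertex) : seq {mpoly K[#|{: cycle_var}|]} :=
  [seq xvar (prism_edge_index uv.1 uv.2) | uv <- zip w (rot 1 w)].

(* Indices start at 0, so j.*2 and j.*2.+1 are the positions 2j-1 and 2j of a
   numbering starting at 1. *)
Definition walk_binomial (w : seq prism_vertex) : {mpoly K[#|{: cycle_var}|]} :=
  \prod_(j < (size w)./2) (walk_vars w)`_(j.*2)
  - \prod_(j < (size w)./2) (walk_vars w)`_(j.*2.+1).

Definition even_cycle (w : seq prism_vertex) : bool :=
  [&& (3 <= size w)%N, ~~ odd (size w), uniq w & closed_walk w].

Definition around (i : 'I_k) : seq 'I_k := traject (@ordS k) i k.+1.

(* p_i, ..., p_i, q_i, ..., q_i: once around C, across {p_i,q_i}, once around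
   C', and back to p_i. As k is odd, reversing the direction in which C or C'
   is traversed does not change the binomial. *)
Definition two_cycle_walk (i : 'I_k) : seq prism_vertex :=
  [seq inl j | j <- around i] ++ [seq inr j | j <- around i].

End CycleIdeal.

(* Main.v *)
Require Import Defs.
From mathcomp Require Import all_boot all_order all_algebra zify ring.
Local Open Scope ring_scope.

Set Implicit Arguments.
Unset Strict Implicit.
Unset Printing Implicit Defensive.
Import GRing.Theory Num.Theory Order.TTheory.

(** The ideal P_C is the toric ideal of the prism: sending each variable to the
    product of the two end points of its edge, two monomials have the same
    image (the same toric degree) exactly when their difference lies in P_C.
    One inclusion holds on generators, the edge binomials being the binomials
    of the squares of the prism ([in_cycle_ideal_balanced]).  For the other,
    rewriting x_ab x_ba into x_aa x_bb brings every monomial to a form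
    determined by its degree, because a vector z in the kernel of the incidence
    matrix takes the same value on the edges {p_i,p_{i+1}} and {q_i,q_{i+1}}:
    the difference changes sign from i to i+1, and the cycle is odd
    ([in_cycle_ideal_binomial]).

    For any toric ideal with finite fibres, a binomial of a reduced Groebner
    basis is primitive: no other pair of monomials of equal degree divides its
    two terms ([universal_groebner_basis_primitive]).  Conversely a circuit, a
    pair with disjoint supports such that the kernel vectors supported there
    are its multiples, is reduced for an order eliminating the variables
    outside its support; the reduced pairs of an order always form a reduced
    Groebner basis, hence circuits belong to the universal Groebner basis
    ([circuit_universal_groebner_basis]).

    It remains to see that in the prism of an odd cycle the primitive binomials
    and the circuits are both given by the walks of the theorem.  A kernel
    vector supported on an even cycle alternates along it, since each vertex of
    the cycle meets only two of its edges; a similar argument on C applies to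
    the walk (C, {p_i,q_i}, C').  So these walks are circuits
    ([circuit_walk_circuit]).  Next, let z be a nonzero kernel vector.  Among the
    edges of C where |z| is maximal, start at one whose predecessor does not
    carry the opposite value (one exists because C is odd), and follow C as
    long as the values alternate.  If the run stops before closing up, it
    bounds a ladder of the prism, whose boundary is an even cycle; if it goes
    all the way around C, it gives the walk (C, {p_i,q_i}, C').  Maximality
    makes the vector of that walk conformal to z ([conformal_positive]), so a
    primitive binomial equals the binomial of the walk. *)

(** * Leading terms of binomials *)

Section Binomials.
Variables (K : fieldType) (m : nat).
Implicit Types (u v w : 'X_{1..m}) (f g : {mpoly K[m]}) (le : rel 'X_{1..m}).

Lemma mcoeff_monomialB u v w :
  ('X_[u] - 'X_[v] : {mpoly K[m]})@_w = (u == w)%:R - (v == w)%:R.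
Proof. by rewrite mcoeffB !mcoeffX. Qed.

Lemma msupp_monomialB u v w : u != v ->
  (w \in msupp ('X_[u] - 'X_[v] : {mpoly K[m]})) = (w == u) || (w == v).
Proof.
move=> uv; rewrite mcoeff_msupp mcoeff_monomialB ![w == _]eq_sym.
have [<-|_] := eqVneq u w; first by rewrite [v == u]eq_sym (negPf uv) subr0 oner_neq0.
by rewrite sub0r oppr_eq0; case: (v == w); rewrite ?oner_neq0 ?eqxx.
Qed.

Lemma leading_monomialB le u v : term_order le -> u != v -> le v u ->
  leading le ('X_[u] - 'X_[v] : {mpoly K[m]}) u.
Proof.
move=> [_ _ tot _ _] uv vu; split; first by rewrite msupp_monomialB ?eqxx.
move=> w; rewrite msupp_monomialB // => /orP[] /eqP-> //.
by case/orP: (tot u u).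
Qed.

Lemma leading_uniq le f u v : antisymmetric le ->
  leading le f u -> leading le f v -> u = v.
Proof. by move=> anti [uf fu] [vf fv]; apply: anti; rewrite fu ?fv. Qed.

(** In an ideal generated by monomials, a monomial is divisible by one of the
    generators: some summand must contribute to its coefficient. *)
Lemma monomial_in_initial_ideal le (S : {mpoly K[m]} -> Prop) w :
  in_initial_ideal le S 'X_[w] ->
  exists f u, [/\ S f, leading le f u & (u <= w)%MM].
Proof.
case=> s [sS Ew].
have /allPn[c cs]: ~~ all (fun c : {mpoly K[m]} * {mpoly K[m]} => (c.1 * c.2)@_w == 0) s.
  apply/negP => /allP s0; have := mcoeffX K w w.
  rewrite eqxx {1}Ew raddf_sum big1_seq /= => [|c /s0/eqP//].
  by move/esym/eqP; rewrite oner_eq0.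
have [f [u [Sf fu ->]]] := sS c cs.
rewrite -mcoeff_msupp (perm_mem (msuppMX _ _)) => /mapP[t _ ->].
by exists f, u; split=> //; apply: lem_addr.
Qed.

End Binomials.

(** * Term orders *)

Section TermOrder.
Variables (m : nat) (le : rel 'X_{1..m}).
Hypothesis le_order : term_order le.
Implicit Types (u v w : 'X_{1..m}).

Lemma term_order_refl u : le u u.
Proof. by case: le_order => _ _ tot _ _; case/orP: (tot u u). Qed.

Lemma term_order_addI w u v : le (u + w)%MM (v + w)%MM -> le u v.
Proof.
case: le_order => anti _ tot _ mon uv; case/orP: (tot u v) => // vu.
have /addIm-> : (u + w = v + w)%MM by apply: anti; rewrite uv mon.
exact: term_order_refl.
Qed.

Lemma term_order_muln u v c : le u v -> le (u *+ c)%MM (v *+ c)%MM.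
Proof.
case: le_order => _ tr _ _ mon uv.
elim: c => [|c IH]; first by rewrite !mulm0n term_order_refl.
rewrite !mulmS; apply: (tr (v + u *+ c)%MM); first exact: mon.
by rewrite ![(v + _)%MM]addmC; apply: mon.
Qed.

Lemma seq_has_least (s : seq 'X_{1..m}) u : u \in s ->
  exists2 v, v \in s & forall w, w \in s -> le v w.
Proof.
case: le_order => _ tr tot _ _.
elim: s u => // a [|b s] IH u _.
  by exists a; rewrite ?inE // => w; rewrite inE => /eqP->; apply: term_order_refl.
have [v vs vmin] := IH b (mem_head _ _).
case/orP: (tot a v) => av.
  exists a; rewrite ?mem_head // => w; rewrite inE => /predU1P[->|/vmin].
    exact: term_order_refl.
  exact: tr.
by exists v => [|w]; rewrite inE ?vs ?orbT // => /predU1P[->|/vmin].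
Qed.

End TermOrder.

(** Monomials free of the variables in T are smaller than all the others. *)
Definition elimination_order m (T : {set 'I_m}) : rel 'X_{1..m} :=
  fun u v =>
    (\sum_(i in T) u i < \sum_(i in T) v i)%N
    || (\sum_(i in T) u i == \sum_(i in T) v i)%N && (u <= v)%O.

Lemma elimination_order_term_order m (T : {set 'I_m}) :
  term_order (elimination_order T).
Proof.
rewrite /elimination_order.
have wD (u v : 'X_{1..m}) :
    (\sum_(i in T) (u + v)%MM i = \sum_(i in T) u i + \sum_(i in T) v i)%N.
  by rewrite -big_split; apply: eq_bigr => i _; rewrite mnmDE.
split.
- move=> u v; case: ltngtP => //= _ /andP[uv vu].
  by apply/eqP; rewrite eq_le uv vu.
- move=> v u w; do 3![case: ltngtP => //=]; move=> *; try lia.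
  by apply: le_trans; eassumption.
- by move=> u v; case: ltngtP => //= _; apply: le_total.
- move=> u; rewrite [X in (X < _)%N]big1 => [|i _]; last exact: mnm0E.
  rewrite [X in (X == _)%N]big1 => [|i _]; last exact: mnm0E.
  by case: (posnP (\sum_(i in T) u i)%N) => // ->; rewrite le0m.
move=> w u v; rewrite !wD ltn_add2r eqn_add2r.
by case: ltngtP => //= _; rewrite lemc_add2l.
Qed.

(** * Toric degrees and balanced polynomials *)

Section ToricDegree.
Variables (K : fieldType) (m : nat) (J : finType) (A : 'I_m -> J -> nat).
Implicit Types (u v w : 'X_{1..m}) (f g : {mpoly K[m]}).

Definition toric_degree u : {ffun J -> nat} :=
  [ffun j => \sum_i u i * A i j]%N.

Local Notation deg := toric_degree.

Lemma toric_degreeD u v j : deg (u + v)%MM j = (deg u j + deg v j)%N.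
Proof.
rewrite !ffunE -big_split; apply: eq_bigr => i _.
by rewrite mnmDE mulnDl.
Qed.

Lemma toric_degree_addr w u v : deg u = deg v -> deg (u + w)%MM = deg (v + w)%MM.
Proof. by move=> uv; apply/ffunP => j; rewrite !toric_degreeD uv. Qed.

(** The coefficients sum to 0 over each degree, that is, f is in the kernel of
    the monomial map with exponent matrix A.  This form avoids introducing a
    target polynomial ring. *)
Definition balanced f :=
  forall d, \sum_(w <- msupp f | deg w == d) f@_w = 0.

Lemma class_sum_widen f d (s : seq 'X_{1..m}) :
  uniq s -> {subset msupp f <= s} ->
  \sum_(w <- msupp f | deg w == d) f@_w = \sum_(w <- s | deg w == d) f@_w.
Proof.
move=> s_uniq fs; rewrite [RHS](bigID (mem (msupp f))) /= [X in _ + X]big1.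
  rewrite addr0 [RHS](eq_bigl (fun w => (w \in msupp f) && (deg w == d))).
    rewrite -[RHS]big_filter_cond; apply: perm_big; apply: uniq_perm.
    - exact: msupp_uniq.
    - exact: filter_uniq.
    - by move=> w; rewrite mem_filter; case: (boolP (w \in msupp f)) => // /fs->.
  by move=> w; rewrite andbC.
by move=> w /andP[_ /memN_msupp_eq0].
Qed.

Lemma balanced0 : balanced 0.
Proof. by move=> d; rewrite big1 // => w; rewrite mcoeff0. Qed.

Lemma balancedD f g : balanced f -> balanced g -> balanced (f + g).
Proof.
move=> bf bg d; pose s := undup (msupp (f + g) ++ msupp f ++ msupp g).
have s_uniq : uniq s by apply: undup_uniq.
rewrite (@class_sum_widen _ _ s) //; last first.
  by move=> w; rewrite mem_undup mem_cat => ->.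
under eq_bigr do rewrite mcoeffD.
rewrite big_split /= -!class_sum_widen ?bf ?bg ?addr0 //.
all: by move=> w; rewrite mem_undup !mem_cat => ->; rewrite ?orbT.
Qed.

Lemma balanced_monomialB (a : K) u v :
  deg u = deg v -> balanced (a *: ('X_[u] - 'X_[v])).
Proof.
move=> uv; have [->|neq] := eqVneq u v.
  by rewrite subrr scaler0; apply: balanced0.
move=> d; rewrite (@class_sum_widen _ _ [:: u; v]) /=.
- rewrite !big_cons big_nil -uv !mcoeffZ !mcoeff_monomialB !eqxx.
  rewrite [v == u]eq_sym (negPf neq); case: (deg u == d); rewrite ?addr0 //.
  by rewrite mulr1n mulr0n subr0 sub0r mulrN subrr.
- by rewrite inE andbT.
move=> w /msuppZ_le; rewrite msupp_monomialB //.
by rewrite !inE.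
Qed.

Lemma in_ideal_gen_balanced (S : {mpoly K[m]} -> Prop) f :
  (forall g, S g -> exists u v, deg u = deg v /\ g = 'X_[u] - 'X_[v]) ->
  in_ideal_gen S f -> balanced f.
Proof.
move=> Sbin [s [sS ->]]; rewrite big_seq_cond.
apply: (big_ind balanced) => [||c /andP[cs _]]; first exact: balanced0.
  exact: balancedD.
have [u [v [uv ->]]] := Sbin _ (sS c cs).
rewrite [c.1]mpolyE mulr_suml.
apply: (big_ind balanced) => [||t _]; first exact: balanced0.
  exact: balancedD.
rewrite -mpoly_scaleAl mulrBr -!mpolyXD.
by apply: balanced_monomialB; rewrite ![(t + _)%MM]addmC; apply: toric_degree_addr.
Qed.

(** A single monomial of a given degree could not have its coefficient
    cancelled. *)
Lemma balanced_partner f u : balanced f -> u \in msupp f ->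
  exists v, [/\ v \in msupp f, v != u & deg u = deg v].
Proof.
move=> bf uf; have /allPn[v vf] :
    ~~ all (fun v => (v != u) ==> (deg v != deg u)) (msupp f).
  apply/negP => /allP f0; have := bf (deg u).
  rewrite -big_filter (bigD1_seq u) ?filter_uniq ?mem_filter ?eqxx ?msupp_uniq //=.
  rewrite big1_seq ?addr0; first by move/eqP; rewrite mcoeff_eq0 uf.
  by move=> v /andP[neq]; rewrite mem_filter => /andP[vu /f0]; rewrite neq vu.
by rewrite negb_imply negbK => /andP[neq /eqP vu]; exists v.
Qed.

Lemma balanced_monomialB_deg u v : balanced ('X_[u] - 'X_[v]) -> deg u = deg v.
Proof.
have [->//|neq] := eqVneq u v => /balanced_partner-/(_ u).
rewrite !msupp_monomialB // eqxx => -[//|w].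
rewrite msupp_monomialB // => -[/orP[]/eqP-> //]; by rewrite eqxx.
Qed.

Lemma balanced_binomial f u : balanced f -> binomial_poly f ->
  u \in msupp f -> f@_u = 1 ->
  exists v, [/\ v != u, deg u = deg v & f = 'X_[u] - 'X_[v]].
Proof.
move=> bf f2 uf fu1; have [v [vf vu uv]] := balanced_partner bf uf.
exists v; split=> //.
have Ef : perm_eq (msupp f) [:: u; v].
  have uv_uniq : uniq [:: u; v] by rewrite /= inE eq_sym vu.
  have uv_sub : {subset [:: u; v] <= msupp f}.
    by move=> w; rewrite !inE => /orP[] /eqP->.
  have [|_ Ef] := uniq_min_size uv_uniq uv_sub; first by rewrite (eqP f2).
  by rewrite perm_sym; apply: uniq_perm => //; apply: msupp_uniq.
have := bf (deg u); rewrite (perm_big _ Ef) !big_cons big_nil -uv eqxx /= addr0 fu1.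
move/eqP; rewrite addrC addr_eq0 => /eqP fv.
by rewrite [LHS]mpolyE (perm_big _ Ef) big_cons big_seq1 fu1 fv scaleN1r scale1r.
Qed.

End ToricDegree.

(** * Standard monomials and reduced pairs *)

Section ToricFibres.
Variables (m : nat) (J : finType) (A : 'I_m -> J -> nat).
Hypothesis A_pos : forall i, exists j, (0 < A i j)%N.
Implicit Types (u v w : 'X_{1..m}).

Local Notation deg := (toric_degree A).

(** The only monomial of degree 0 is 1, since no variable has degree 0. *)
Lemma toric_degree_le_inj u v : (v <= u)%MM -> deg v = deg u -> v = u.
Proof.
move=> /submK <-; set w := (u - v)%MM => /ffunP vu.
suff -> : w = 0%MM by rewrite add0m.
apply/mnmP => i; have [j Aij] := A_pos i; rewrite mnm0E.
have /esym/eqP := vu j; rewrite toric_degreeD -[X in _ == X]add0n eqn_add2r.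
rewrite ffunE sum_nat_eq0 => /forallP/(_ i).
by rewrite muln_eq0 => /orP[/eqP//|]; rewrite eqn0Ngt Aij.
Qed.

(** Bounds the total degree along a fibre, hence fibres are finite. *)
Lemma mdeg_le_toric_degree u : (mdeg u <= \sum_j deg u j)%N.
Proof.
rewrite mdegE; under [X in (_ <= X)%N]eq_bigr do rewrite ffunE.
rewrite exchange_big; apply: leq_sum => i _; have [j Aij] := A_pos i.
by rewrite (bigD1 j) //= (leq_trans (leq_pmulr _ Aij)) // leq_addr.
Qed.

(** For u and v of equal degree this is primitivity of the binomial X^u - X^v,
    that is, membership in the Graver basis. *)
Definition primitive_pair u v := forall u' v',
  deg u' = deg v' -> u' != v' -> (u' <= u)%MM -> (v' <= v)%MM ->
  u' = u /\ v' = v.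

Variable le : rel 'X_{1..m}.

(** The initial monomials of the toric ideal.  Fibres of the degree map are
    finite, which makes the predicate boolean. *)
Definition nonstandard u :=
  [exists v : 'X_{1..m < (\sum_j deg u j).+1},
     [&& deg v == deg u, le v u & (v : 'X_{1..m}) != u]].

Lemma nonstandardP u :
  reflect (exists v, [/\ deg v = deg u, le v u & v != u]) (nonstandard u).
Proof.
apply: (iffP existsP) => [[v /and3P[/eqP vu le_vu neq]]|[v [vu le_vu neq]]].
  by exists v.
have vb : (mdeg v < (\sum_j deg u j).+1)%N by rewrite ltnS -vu mdeg_le_toric_degree.
by exists (BMultinom vb); rewrite /= vu eqxx le_vu.
Qed.

Hypothesis le_order : term_order le.

Lemma nonstandard_mono u w : (u <= w)%MM -> nonstandard u -> nonstandard w.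
Proof.
move=> /submK <- /nonstandardP[v [vu le_vu neq]]; set t := (w - u)%MM.
rewrite addmC; apply/nonstandardP; exists (v + t)%MM; split.
- exact: toric_degree_addr.
- by case: le_order => _ _ _ _; apply.
- by rewrite eqm_add2r.
Qed.

Lemma nonstandard_or u v : deg u = deg v -> u != v ->
  nonstandard u \/ nonstandard v.
Proof.
move=> uv neq; case: (le_order) => _ _ tot _ _.
case/orP: (tot u v) => ?; [right|left]; apply/nonstandardP.
  by exists u.
by exists v; rewrite eq_sym.
Qed.

Lemma standard_uniq u v : deg u = deg v ->
  ~~ nonstandard u -> ~~ nonstandard v -> u = v.
Proof.
move=> uv nu nv; apply/eqP; apply: contraT => /(nonstandard_or uv).
by case=> ns; [move: nu | move: nv]; rewrite ns.
Qed.

(** The least monomial of a fibre is its standard representative. *)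
Lemma standard_exists u : exists2 v, deg v = deg u & ~~ nonstandard v.
Proof.
pose b := (\sum_j deg u j).+1.
pose s := [seq val x | x : 'X_{1..m < b} <- enum {: 'X_{1..m < b}} & deg x == deg u].
have mem_s v : (v \in s) = (deg v == deg u).
  apply/mapP/eqP => [[x]|vu]; first by rewrite mem_filter => /andP[/eqP <- _] ->.
  have vb : (mdeg v < b)%N by rewrite ltnS -vu mdeg_le_toric_degree.
  by exists (BMultinom vb); rewrite // mem_filter mem_enum vu eqxx.
have [|v] := @seq_has_least _ _ le_order s u; first by rewrite mem_s.
rewrite mem_s => /eqP vu vmin; exists v => //; apply/negP => /nonstandardP[w [wv le_wv]].
case: (le_order) => anti _ _ _ _ /eqP; apply; apply: anti.
by rewrite le_wv vmin // mem_s wv vu.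
Qed.

(** The leading and trailing exponents of the elements of the reduced Groebner
    basis: a minimal generator of the initial ideal and its normal form. *)
Definition reduced_pair u v :=
  [&& deg u == deg v, nonstandard u, ~~ nonstandard v
    & [forall i, (0 < u i)%N ==> ~~ nonstandard (u - U_(i))%MM]].

Lemma reduced_pairP u v :
  reflect [/\ deg u = deg v, nonstandard u, ~~ nonstandard v
            & forall u', (u' <= u)%MM -> nonstandard u' -> u' = u]
          (reduced_pair u v).
Proof.
apply: (iffP and4P) => [[/eqP ? ? ? /forallP umin]|[uv nu nv umin]]; split=> //.
- move=> u' /mnm_lepP u'u nu'; apply/mnmP => i.
  apply/eqP; rewrite eqn_leq u'u /= leqNgt; apply/negP => u'u_lt.
  have /implyP := umin i; rewrite (leq_ltn_trans _ u'u_lt) // => /(_ isT)/negP; apply.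
  apply: nonstandard_mono nu'; apply/mnm_lepP => i'; rewrite mnmBE mnm1E.
  by case: eqVneq => [<-|_]; have := u'u i'; lia.
- exact/eqP.
apply/forallP => i; apply/implyP => ui; apply/negP => /umin-/(_ (lem_subr _ _)).
by move/mnmP/(_ i); rewrite mnmBE mnm1E eqxx /=; lia.
Qed.

Lemma reduced_pair_neq u v : reduced_pair u v -> u != v.
Proof. by case/reduced_pairP => _ nu nv _; apply: contraNneq nv => <-. Qed.

(** If (u', v') divides (u, v) termwise, the larger of u' and v' is nonstandard.
    It cannot be v', which divides a standard monomial, and if it is u' then
    minimality of u gives u' = u. *)
Lemma reduced_pair_primitive u v : reduced_pair u v -> primitive_pair u v.
Proof.
case/reduced_pairP=> uv nu nv umin u' v' u'v' neq u'u v'v.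
have [nu'|nv'] := nonstandard_or u'v' neq; last first.
  by rewrite (nonstandard_mono v'v) in nv.
have u'_eq := umin _ u'u nu'; split=> //.
by apply: toric_degree_le_inj; rewrite // -u'v' u'_eq.
Qed.

Lemma reduced_pair_le u v : reduced_pair u v -> le v u.
Proof.
move=> red; case/reduced_pairP: (red) => uv _ nv _; case: (le_order) => _ _ tot _ _.
case/orP: (tot v u) => // le_uv; case/nonstandardP: nv.
by exists u; split=> //; apply: reduced_pair_neq red.
Qed.

Lemma reduced_pair_exists w : nonstandard w ->
  exists u v, reduced_pair u v /\ (u <= w)%MM.
Proof.
have [d] := ubnP (mdeg w); elim: d w => // d IH w wd nw.
case: (boolP [exists i, (0 < w i)%N && nonstandard (w - U_(i))%MM]).
  case/existsP=> i /andP[wi nwi]; have [|u [v [uv uw]]] := IH _ _ nwi.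
    have Ui : (U_(i) <= w)%MM by rewrite lep1mP -lt0n.
    have := congr1 mdeg (submK Ui); rewrite mdegD mdeg1; lia.
  by exists u, v; split=> //; apply: lepm_trans uw (lem_subr _ _).
rewrite negb_exists => /forallP wmin; have [v vw nv] := standard_exists w.
exists w, v; split; last exact: lepm_refl.
rewrite /reduced_pair vw eqxx nw nv /=; apply/forallP => i; apply/implyP => wi.
by have := wmin i; rewrite wi.
Qed.

End ToricFibres.

(** * The universal Groebner basis of a toric ideal *)

Section ToricIdeal.
Variables (K : fieldType) (m : nat) (J : finType) (A : 'I_m -> J -> nat).
Variable I : {mpoly K[m]} -> Prop.
Implicit Types (u v w : 'X_{1..m}) (f g : {mpoly K[m]}).
Local Notation deg := (toric_degree A).

Hypothesis A_pos : forall i, exists j, (0 < A i j)%N.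
Hypothesis I_balanced : forall f, I f -> balanced A f.
Hypothesis I_binomial : forall u v, deg u = deg v -> I ('X_[u] - 'X_[v]).

Lemma leading_nonstandard le f u : I f -> leading le f u -> nonstandard A le u.
Proof.
move=> If [uf fu]; have [v [vf vu uv]] := balanced_partner (I_balanced If) uf.
by apply/nonstandardP => //; exists v; rewrite fu.
Qed.

Lemma nonstandard_leading le u : term_order le -> nonstandard A le u ->
  exists2 f, I f & leading le f u.
Proof.
move=> le_order /nonstandardP-/(_ A_pos)[v [vu le_vu neq]].
exists ('X_[u] - 'X_[v]); first exact: I_binomial.
by apply: leading_monomialB; rewrite // eq_sym.
Qed.

(** Only the binomial itself can have a leading monomial dividing one of its
    terms, by reducedness.  A smaller pair of the same degree has a nonstandard
    member, so this member is a multiple of u, and finiteness of the fibres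
    forces equality. *)
Lemma universal_groebner_basis_primitive f :
  binomial_poly f -> universal_groebner_basis I f ->
  exists u v, [/\ f = 'X_[u] - 'X_[v], deg u = deg v & primitive_pair A u v].
Proof.
move=> f2 [le [s [le_order [[sI s_init] s_monic s_red] fs]]].
have [u lead_u fu] := s_monic f fs.
have [v [vu uv Ef]] :=
  balanced_binomial (I_balanced (sI _ fs)) f2 (proj1 lead_u) fu.
exists u, v; split=> //.
have uf : u \in msupp f by case: lead_u.
have vf : v \in msupp f by rewrite Ef msupp_monomialB ?eqxx ?orbT // eq_sym.
(* By reducedness, the basis element whose leading monomial divides w is f. *)
have divides w t : nonstandard A le w -> (w <= t)%MM -> t \in msupp f -> (u <= w)%MM.
  move=> nw wt tf; have [h Ih lead_h] := nonstandard_leading le_order nw.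
  have /s_init/monomial_in_initial_ideal[g [x [gs lead_x xw]]] :
      in_initial_ideal le I 'X_[w].
    exists [:: (1, 'X_[w])]; split; last by rewrite big_seq1 mul1r.
    by move=> c; rewrite inE => /eqP->; exists h, w.
  have [gf|gf] := eqVneq g f; last first.
    by have := s_red _ _ _ _ gs fs gf lead_x tf; rewrite (lepm_trans xw wt).
  rewrite gf in lead_x; case: le_order => anti _ _ _ _.
  by rewrite (leading_uniq anti lead_u lead_x).
move=> u' v' u'v' neq u'u v'v.
have [nu'|nv'] := nonstandard_or A_pos le_order u'v' neq.
  have uu' := divides _ _ nu' u'u uf.
  have u'_eq : u' = u.
    apply/mnmP => i; apply/eqP; rewrite eqn_leq.
    by rewrite (mnm_lepP u'u) (mnm_lepP uu').
  by split=> //; apply: (toric_degree_le_inj A_pos); rewrite // -u'v' u'_eq.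
have uv' : (u <= v)%MM by apply: lepm_trans (divides _ _ nv' v'v vf) v'v.
by rewrite (toric_degree_le_inj A_pos uv' uv) eqxx in vu.
Qed.

(** Primitive pairs have bounded degree as the Graver basis is finite; the
    explicit bound replaces Dickson's lemma and makes the reduced basis a
    list. *)
Variable D : nat.
Hypothesis primitive_bounded : forall u v, deg u = deg v -> u != v ->
  primitive_pair A u v -> (mdeg u <= D)%N /\ (mdeg v <= D)%N.

Definition reduced_basis le : seq {mpoly K[m]} :=
  [seq 'X_[x.1] - 'X_[x.2]
     | x : 'X_{1..m < D.+1} * 'X_{1..m < D.+1}
         <- enum {: 'X_{1..m < D.+1} * 'X_{1..m < D.+1}}
     & reduced_pair A le x.1 x.2].

Lemma mem_reduced_basis le f : term_order le ->
  reflect (exists u v, reduced_pair A le u v /\ f = 'X_[u] - 'X_[v])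
          (f \in reduced_basis le).
Proof.
move=> le_order; apply: (iffP mapP) => [[x]|[u [v [uv ->]]]].
  by rewrite mem_filter => /andP[xr _] ->; exists x.1, x.2.
have [uD vD] : (mdeg u <= D)%N /\ (mdeg v <= D)%N.
  apply: primitive_bounded.
  - by case/reduced_pairP: uv.
  - exact: reduced_pair_neq uv.
  - exact: reduced_pair_primitive uv.
exists (BMultinom (uD : mdeg u < D.+1)%N, BMultinom (vD : mdeg v < D.+1)%N); last by [].
by rewrite mem_filter mem_enum; apply/andP; split.
Qed.

(** The initial ideals agree because every nonstandard monomial is divisible by
    the first member of a reduced pair.  Two reduced pairs with the same first
    member have standard second members of equal degree, which coincide. *)
Lemma reduced_basis_correct le :
  term_order le -> reduced_groebner_basis le I (reduced_basis le).
Proof.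
move=> le_order.
have lead u v : reduced_pair A le u v ->
    leading le ('X_[u] - 'X_[v] : {mpoly K[m]}) u.
  move=> uv; apply: leading_monomialB (reduced_pair_neq A_pos le_order uv) _ => //.
  exact: reduced_pair_le uv.
have basisI g : g \in reduced_basis le -> I g.
  case/(mem_reduced_basis _ le_order) => u [v [+ ->]].
  move=> /reduced_pairP-/(_ A_pos le_order)[uv _ _ _].
  exact: I_binomial.
have anti : antisymmetric le by case: le_order.
split.
- split=> // h; split=> [[s [sI ->]]|[s [sB Eh]]]; last first.
    exists s; split=> // c /sB[f [u [fB fu ->]]].
    by exists f, u; split=> //; apply: basisI.
  elim: s sI => [|c s IH] sI; first by exists [::]; rewrite !big_nil.
  have [|s' [s'B Es']] := IH; first by move=> d ds; apply: sI; rewrite inE ds orbT.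
  have [f [w [If fw Ec]]] := sI c (mem_head _ _).
  have [u [v [uv uw]]] :=
    reduced_pair_exists A_pos le_order (leading_nonstandard If fw).
  exists ((c.1 * 'X_[w - u], 'X_[u]) :: s'); split.
    move=> d; rewrite inE => /predU1P[->|/s'B//].
    exists ('X_[u] - 'X_[v]), u; split=> //; last exact: lead.
    by apply/(mem_reduced_basis _ le_order); exists u, v.
  by rewrite !big_cons Es' /= Ec -mulrA -mpolyXD submK.
- move=> g /(mem_reduced_basis _ le_order)[u [v [uv ->]]].
  exists u; first exact: lead.
  have := reduced_pair_neq A_pos le_order uv.
  by rewrite mcoeff_monomialB eqxx eq_sym => /negPf->; rewrite subr0.
move=> g g' x y /(mem_reduced_basis _ le_order)[u [v [uv ->]]].
move=> /(mem_reduced_basis _ le_order)[u' [v' [uv' ->]]] neq.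
move=> /(leading_uniq anti (lead _ _ uv)) <-.
rewrite msupp_monomialB ?(reduced_pair_neq A_pos le_order uv') // => yuv.
apply/negP => uy; case/reduced_pairP: (uv) => // deg_uv nu nv _.
case/reduced_pairP: (uv') => // deg_uv' nu' nv' umin'.
case/orP: yuv => /eqP Ey; rewrite Ey in uy; last first.
  by rewrite (nonstandard_mono A_pos le_order uy nu) in nv'.
have u_eq := umin' _ uy nu; case/eqP: neq; rewrite u_eq; congr (_ - 'X_[_]).
by apply: standard_uniq nv nv'; rewrite // -deg_uv -deg_uv' u_eq.
Qed.

(** The last clause says that the kernel vectors supported on the variables of
    X^u and X^v form a lattice of rank one spanned by u - v. *)
Definition circuit_pair u v :=
  [/\ deg u = deg v, u != v, forall i, u i = 0%N \/ v i = 0%N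
    & forall u' v', deg u' = deg v' ->
        (forall i, u i = 0%N -> v i = 0%N -> u' i = 0%N /\ v' i = 0%N) ->
        exists t : int, forall i, (u' i)%:Z - (v' i)%:Z = t * ((u i)%:Z - (v i)%:Z)].

Lemma circuit_pairC u v : circuit_pair u v -> circuit_pair v u.
Proof.
case=> uv neq disj rank1; split=> //; first by rewrite eq_sym.
  by move=> i; case: (disj i); [right | left].
move=> u' v' u'v' supp; have [i ui vi|t Et] := rank1 u' v' u'v'; first exact: supp.
by exists (- t) => i; rewrite Et; ring.
Qed.

(** For the order eliminating the variables outside the support of the circuit,
    every relation whose leading monomial is supported on the circuit is a
    multiple of u - v.  As u and v have disjoint supports, its leading monomial
    is then a multiple of u. *)
Lemma circuit_reduced_pair u v (S := [set i | (u i == 0%N) && (v i == 0%N)]) :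
  circuit_pair u v -> elimination_order S v u ->
  reduced_pair A (elimination_order S) u v.
Proof.
set le := elimination_order S => -[uv neq disj rank1] le_vu.
have le_order : term_order le := elimination_order_term_order S.
have elim u' v' : le v' u' -> (forall i, i \in S -> u' i = 0%N) ->
    forall i, i \in S -> v' i = 0%N.
  move=> le_v'u' u'0 i iS; move: le_v'u'; rewrite /le /elimination_order.
  rewrite [X in (_ < X)%N]big1 // [X in (_ == X)%N]big1 // ltn0 /=.
  by rewrite sum_nat_eq0 => /andP[/forall_inP/(_ i iS)/eqP].
have nonstd_mult w : nonstandard A le w -> (forall i, i \in S -> w i = 0%N) ->
    exists2 t : nat, (0 < t)%N & forall i, (t * u i <= w i + t * v i)%N.
  move=> /nonstandardP-/(_ A_pos)[w' [ww' le_w'w w'w]] wS.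
  have [|t Et] := rank1 w w' (esym ww').
    move=> i ui vi; have iS : i \in S by rewrite inE ui vi.
    by rewrite wS // (elim _ _ le_w'w).
  case: t Et => [[|t]|t] Et.
  - case/eqP: w'w; apply/mnmP => i; have := Et i; rewrite mul0r; lia.
  - by exists t.+1 => // i; have := Et i; nia.
  (* Otherwise w' is w plus a positive multiple of u - v, hence not smaller. *)
  have Ew : (w' + v *+ t.+1 = w + u *+ t.+1)%MM.
    apply/mnmP => i; rewrite !mnmDE !mulmnE; have := Et i; rewrite NegzE; lia.
  have le_ww' : le w w'.
    apply: (term_order_addI le_order (w := (v *+ t.+1)%MM)); rewrite Ew.
    case: (le_order) => _ _ _ _ mon; rewrite ![(w + _)%MM]addmC; apply: mon.
    exact: term_order_muln.
  case: (le_order) => anti _ _ _ _; case/eqP: w'w; apply: anti.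
  by rewrite le_w'w.
have nu : nonstandard A le u by apply/nonstandardP => //; exists v; rewrite eq_sym.
apply/reduced_pairP => //; split=> //.
- apply/negP => /nonstd_mult[i|t t_gt0 tuv]; first by rewrite inE => /andP[_ /eqP].
  case/negP: neq; apply/eqP/(toric_degree_le_inj A_pos) => //.
  apply/mnm_lepP => i; case: (disj i) => [->//|vi].
  have := tuv i; rewrite vi; nia.
move=> w wu /nonstd_mult[i|t t_gt0 tuw].
  rewrite inE => /andP[/eqP ui _]; have := mnm_lepP wu i; rewrite ui; lia.
apply/mnmP => i; have := mnm_lepP wu i; have := tuw i.
by case: (disj i) => E; rewrite E; nia.
Qed.

Lemma circuit_universal_groebner_basis u v : circuit_pair u v ->
  universal_groebner_basis I ('X_[u] - 'X_[v])
  \/ universal_groebner_basis I ('X_[v] - 'X_[u]).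
Proof.
move=> uv; pose S := [set i | (u i == 0%N) && (v i == 0%N)].
have le_order : term_order (elimination_order S) := elimination_order_term_order S.
have in_ugb x y : reduced_pair A (elimination_order S) x y ->
    universal_groebner_basis I ('X_[x] - 'X_[y]).
  move=> xy; exists (elimination_order S), (reduced_basis (elimination_order S)).
  split=> //; first exact: reduced_basis_correct.
  by apply/mem_reduced_basis => //; exists x, y.
case: (le_order) => _ _ tot _ _; case/orP: (tot v u) => le_uv; [left|right].
  exact/in_ugb/circuit_reduced_pair.
apply: in_ugb; have := @circuit_reduced_pair v u (circuit_pairC uv).
have -> : [set i | (v i == 0%N) && (u i == 0%N)] = S.
  by apply/setP => i; rewrite !inE andbC.
exact.
Qed.

End ToricIdeal.

(** * Ideals generated by a set *)

Section IdealClosure.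
Variables (R : comNzRingType) (S : R -> Prop).

Lemma in_ideal_gen0 : in_ideal_gen S 0.
Proof. by exists [::]; rewrite big_nil. Qed.

Lemma in_ideal_gen_mem f : S f -> in_ideal_gen S f.
Proof.
move=> Sf; exists [:: (1, f)]; rewrite big_seq1 mul1r; split=> // c.
by rewrite inE => /eqP->.
Qed.

Lemma in_ideal_genD f g :
  in_ideal_gen S f -> in_ideal_gen S g -> in_ideal_gen S (f + g).
Proof.
move=> [s [sS ->]] [t [tS ->]]; exists (s ++ t); rewrite big_cat; split=> // c.
by rewrite mem_cat => /orP[/sS|/tS].
Qed.

Lemma in_ideal_genM h f : in_ideal_gen S f -> in_ideal_gen S (h * f).
Proof.
move=> [s [sS ->]]; exists [seq (h * c.1, c.2) | c <- s]; split.
  by move=> _ /mapP[c cs ->]; apply: (sS c).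
by rewrite big_map mulr_sumr; apply: eq_bigr => c _; rewrite mulrA.
Qed.

End IdealClosure.

(** * Cyclic indices and supported sums *)

Lemma ordS_iter_val k (i : 'I_k) j : (iter j (@ordS k) i : nat) = ((i + j) %% k)%N.
Proof.
elim: j => [|j IH]; first by rewrite addn0 modn_small.
by rewrite iterS /= IH -addn1 modnDml addn1 addnS.
Qed.

Lemma ordS_iter_inj k (i : 'I_k) j l : (j < k)%N -> (l < k)%N ->
  iter j (@ordS k) i = iter l (@ordS k) i -> j = l.
Proof.
move=> jk lk /(congr1 val); rewrite /= !ordS_iter_val => /eqP.
by rewrite eqn_modDl !modn_small // => /eqP.
Qed.

Lemma ordS_iter_period k (i : 'I_k) : iter k (@ordS k) i = i.
Proof. by apply: val_inj; rewrite /= ordS_iter_val modnDr modn_small. Qed.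

Lemma ordS_iter_onto k (i j : 'I_k) : exists2 l, (l < k)%N & j = iter l (@ordS k) i.
Proof.
have k_gt0 : (0 < k)%N by case: (k) i => [[]|].
exists ((j + (k - i)) %% k)%N; first by rewrite ltn_mod.
apply: val_inj; rewrite /= ordS_iter_val modnDmr.
by rewrite addnCA subnKC 1?ltnW // modnDr modn_small.
Qed.

Lemma sum_seq_support (T : finType) (V : nmodType) (F : T -> V) (s : seq T) :
  uniq s -> (forall x, x \notin s -> F x = 0) -> \sum_x F x = \sum_(x <- s) F x.
Proof.
move=> s_uniq F0; rewrite [RHS]big_uniq // (bigID (mem s)) /= [X in _ + X]big1.
  by rewrite addr0.
by move=> x xs; apply: F0.
Qed.

(** * The prism and the kernel of its incidence matrix *)

Section Prism.
Variables (K : fieldType) (n k : nat) (p : 'I_k -> 'I_n).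
Hypotheses (p_inj : injective p) (k_ge3 : (3 <= k)%N) (k_odd : odd k).

Local Notation var := 'I_#|{: cycle_var p}|.
Local Notation vertex := (prism_vertex k).
Local Notation succ := (@ordS k).
Implicit Types (i j l : 'I_k) (x y t : vertex).

Lemma ordS_neq i : ordS i != i.
Proof. by apply/eqP => /(@ordS_iter_inj _ i 1 0); lia. Qed.

Lemma ordS2_neq i : ordS (ordS i) != i.
Proof. by apply/eqP => /(@ordS_iter_inj _ i 2 0); lia. Qed.

Definition pair_of (v : var) : 'I_n * 'I_n := val (enum_val v).

Fact diag_var_subproof (a : 'I_n) : is_cycle_var p (a, a).
Proof. by rewrite /is_cycle_var eqxx. Qed.

(** Total inverse of [pair_of]; the diagonal default serves the pairs that
    carry no variable. *)
Definition pair_var (ab : 'I_n * 'I_n) : var :=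
  enum_rank (insubd (Sub _ (diag_var_subproof ab.1) : cycle_var p) ab).

Lemma pair_varK ab : is_cycle_var p ab -> pair_of (pair_var ab) = ab.
Proof. by move=> ab_var; rewrite /pair_of enum_rankK val_insubd ab_var. Qed.

Lemma pair_ofK : cancel pair_of pair_var.
Proof.
move=> v; apply: enum_val_inj; apply: val_inj.
by rewrite -[LHS]/(pair_of _) pair_varK // (valP (enum_val v)).
Qed.

Lemma xvarE ab : is_cycle_var p ab -> xvar K p ab = 'X_(pair_var ab).
Proof. by move=> ab_var; rewrite /xvar /pair_var /insubd insubT. Qed.

Definition edge_var x y : var := pair_var (prism_edge_index p x y).

(** Labels (true, a) and (false, a) stand for the two copies of a in the prism
    over all of 'I_n, in which the points off the cycle are isolated in each
    copy.  An edge of the first copy carries the variable x_ab with a < b, one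
    of the second copy the variable x_ba, and {a, a} joins the copies. *)
Definition incidence (v : var) (c : bool * 'I_n) : nat :=
  let ab := pair_of v in
  (if c.1 then ab.1 <= ab.2 else ab.2 <= ab.1)%N && (c.2 \in [:: ab.1; ab.2]).

Definition vertex_label x : bool * 'I_n :=
  match x with inl i => (true, p i) | inr i => (false, p i) end.

Lemma prism_edge_neq x y : prism_edge x y -> x != y.
Proof.
case: x y => [i|i] [j|j] //= ij; apply/eqP => -[E]; move: ij.
all: by rewrite E orbb eq_sym (negPf (ordS_neq _)).
Qed.

Lemma edge_varC x y : prism_edge x y -> edge_var x y = edge_var y x.
Proof. by move=> xy; rewrite /edge_var (prism_edge_index_sym p_inj xy). Qed.

Lemma pair_of_edge_var x y : prism_edge x y ->
  pair_of (edge_var x y) = prism_edge_index p x y.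
Proof. by move/(prism_edge_index_var p)/pair_varK. Qed.

Lemma incidence_edge x y t : prism_edge x y ->
  incidence (edge_var x y) (vertex_label t) = (t \in [:: x; y]).
Proof.
move=> xy; rewrite /incidence pair_of_edge_var //; congr nat_of_bool.
have := prism_edge_neq xy; rewrite !inE.
case: x y t xy => [i|i] [j|j] [l|l] //= xy.
all: rewrite -?[inl _ == inl _]/(_ == _ :> 'I_k) -?[inr _ == inr _]/(_ == _ :> 'I_k).
all: rewrite ?leqnn ?(inj_eq p_inj) ?orbF ?orbb //.
all: try by rewrite (eqP xy).
all: move=> /negPf; rewrite -(inj_eq p_inj) -val_eqE /=.
all: case: ltngtP => //= lt_ij _; rewrite ?(ltnW lt_ij) 1?leqNgt ?lt_ij //=.
all: rewrite ?(inj_eq p_inj) //.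
all: by rewrite orbC.
Qed.

Lemma incidence_edge_off x y b (c : 'I_n) : prism_edge x y -> c \notin codom p ->
  incidence (edge_var x y) (b, c) = 0%N.
Proof.
move=> xy cp; rewrite /incidence pair_of_edge_var //=.
have cE l : (c == p l) = false by apply: contraNF cp => /eqP->; apply: codom_f.
by case: x y xy => [i|i] [j|j] _ /=; do ?case: ifP => _; rewrite /= !inE !cE andbF.
Qed.

Lemma edge_var_inj x y x' y' : prism_edge x y -> prism_edge x' y' ->
  edge_var x y = edge_var x' y' -> (x = x' /\ y = y') \/ (x = y' /\ y = x').
Proof.
move=> xy xy' E; have neq := prism_edge_neq xy.
have xyE t : (t \in [:: x; y]) = (t \in [:: x'; y']).
  have := incidence_edge t xy; rewrite E incidence_edge //.
  by case: (t \in _); case: (t \in _).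
have := xyE x; have := xyE y; rewrite !inE !eqxx orbT.
move=> /esym/orP[]/eqP Ey /esym/orP[]/eqP Ex; auto.
all: by rewrite Ex Ey eqxx in neq.
Qed.

Definition edge_p i : var := edge_var (inl i) (inl (ordS i)).
Definition edge_q i : var := edge_var (inr i) (inr (ordS i)).
Definition edge_pq i : var := edge_var (inl i) (inr i).

Lemma prism_edge_p i : prism_edge (inl i : vertex) (inl (ordS i)).
Proof. by rewrite /= eqxx. Qed.
Lemma prism_edge_q i : prism_edge (inr i : vertex) (inr (ordS i)).
Proof. by rewrite /= eqxx. Qed.
Lemma prism_edge_pq i : prism_edge (inl i : vertex) (inr i).
Proof. exact: eqxx. Qed.

Variant var_spec : var -> Prop :=
  | VarDiag a of a \notin codom p : var_spec (pair_var (a, a))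
  | VarPQ i : var_spec (edge_pq i)
  | VarP i : var_spec (edge_p i)
  | VarQ i : var_spec (edge_q i).

Lemma varP v : var_spec v.
Proof.
rewrite -[v]pair_ofK; have := valP (enum_val v); rewrite -/(pair_of v).
case: (pair_of v) => a b; rewrite /is_cycle_var /=; case: eqVneq => [<- _|ab /=].
  case: (boolP (a \in codom p)) => [/codomP[i ->]|]; last exact: VarDiag.
  exact: (VarPQ i).
have edgeE i :
  edge_p i = pair_var
    (if (p i < p (ordS i))%N then (p i, p (ordS i)) else (p (ordS i), p i)).
  by [].
have edgeE' i :
  edge_q i = pair_var
    (if (p i < p (ordS i))%N then (p (ordS i), p i) else (p i, p (ordS i))).
  by [].
case/existsP=> i /orP[]/eqP-[-> ->]; have := edgeE i; have := edgeE' i.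
all: by case: (p i < p (ordS i))%N => Eq Ep;
  first [rewrite -Eq | rewrite -Ep]; constructor.
Qed.

Lemma incidence_gt0 v : exists c, (0 < incidence v c)%N.
Proof.
rewrite /incidence; case/orP: (leq_total (pair_of v).1 (pair_of v).2) => le_ab.
  by exists (true, (pair_of v).1); rewrite /= le_ab mem_head.
by exists (false, (pair_of v).1); rewrite /= le_ab mem_head.
Qed.

Lemma incidence_diag a b c : incidence (pair_var (a, a)) (b, c) = (c == a).
Proof.
by rewrite /incidence pair_varK ?diag_var_subproof //= leqnn if_same !inE orbb.
Qed.

Local Notation deg := (toric_degree incidence).

Lemma deg_mnm1 v c : deg U_(v)%MM c = incidence v c.
Proof.
rewrite ffunE (bigD1 v) //= mnm1E eqxx mul1n big1 ?addn0 // => i iv.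
by rewrite mnm1E eq_sym (negPf iv).
Qed.

Definition kernel (z : var -> int) : Prop :=
  forall c, \sum_v z v * (incidence v c)%:Z = 0.

Lemma kernel_deg (u v : 'X_{1..#|{: cycle_var p}|}) : deg u = deg v ->
  kernel (fun i : var => (u i)%:Z - (v i)%:Z).
Proof.
move=> uv c; under eq_bigr do rewrite mulrBl.
rewrite sumrB; apply/eqP; rewrite subr_eq0; apply/eqP.
have := congr1 (fun f : {ffun _ -> nat} => (f c)%:Z) uv; rewrite !ffunE.
by rewrite !(big_morph Posz PoszD (erefl _)).
Qed.

Lemma kernel_lin (z z0 : var -> int) (a : int) : kernel z -> kernel z0 ->
  kernel (fun i : var => z i - a * z0 i).
Proof.
move=> kz kz0 c; under eq_bigr do rewrite mulrBl -mulrA.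
by rewrite sumrB -mulr_sumr kz kz0 mulr0 subr0.
Qed.

Section KernelVector.
Variable z : var -> int.
Hypothesis z_ker : kernel z.

(** Edges at t on which z vanishes may be left out of s, which is what lets
    [even_cycle_kernel] forget the third edge at a vertex of a cycle. *)
Lemma kernel_vertex t (s : seq var) : uniq s ->
  (forall v, v \in s -> incidence v (vertex_label t) = 1%N) ->
  (forall v, v \notin s -> z v = 0 \/ incidence v (vertex_label t) = 0%N) ->
  \sum_(v <- s) z v = 0.
Proof.
move=> s_uniq s1 s0; rewrite -[RHS](z_ker (vertex_label t)).
rewrite [RHS](sum_seq_support s_uniq).
  by apply: eq_big_seq => v /s1->; rewrite mulr1.
by move=> v /s0[->|->]; rewrite ?mul0r ?mulr0.
Qed.

Lemma kernel_p i : z (edge_p (ordS i)) + z (edge_p i) + z (edge_pq (ordS i)) = 0.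
Proof.
set t : vertex := inl (ordS i).
have := @kernel_vertex t [:: edge_p (ordS i); edge_p i; edge_pq (ordS i)].
rewrite !big_cons big_nil addr0 addrA; apply.
- rewrite /= !inE !negb_or -!andbA andbT; apply/and3P; split.
  + apply/eqP => /(edge_var_inj (prism_edge_p _) (prism_edge_p _))[[[E] _]|[_ [E]]].
      by have := ordS_neq i; rewrite E eqxx.
    by have := ordS2_neq i; rewrite E eqxx.
  + by apply/eqP => /(edge_var_inj (prism_edge_p _) (prism_edge_pq _))[][].
  + by apply/eqP => /(edge_var_inj (prism_edge_p _) (prism_edge_pq _))[][].
- move=> v; rewrite !inE => /or3P[]/eqP->.
  1-3: by rewrite incidence_edge ?prism_edge_p ?prism_edge_pq // !inE eqxx ?orbT.
move=> v; case: (varP v) => [a ap|j|j|j]; rewrite !inE => vs; right.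
- by rewrite incidence_diag; case: eqP ap => // <-; rewrite codom_f.
- rewrite incidence_edge ?prism_edge_pq // !inE; case: eqP => [[E]|_] /=; last by [].
  by rewrite -E eqxx !orbT in vs.
- rewrite incidence_edge ?prism_edge_p // !inE.
  case: eqP => [[E]|_] /=; first by rewrite -E eqxx in vs.
  by case: eqP => [E|_] //; rewrite -(ordS_inj (inl_inj E)) eqxx !orbT in vs.
by rewrite incidence_edge ?prism_edge_q // !inE.
Qed.

Lemma kernel_q i : z (edge_q (ordS i)) + z (edge_q i) + z (edge_pq (ordS i)) = 0.
Proof.
set t : vertex := inr (ordS i).
have := @kernel_vertex t [:: edge_q (ordS i); edge_q i; edge_pq (ordS i)].
rewrite !big_cons big_nil addr0 addrA; apply.
- rewrite /= !inE !negb_or -!andbA andbT; apply/and3P; split.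
  + apply/eqP => /(edge_var_inj (prism_edge_q _) (prism_edge_q _))[[[E] _]|[_ [E]]].
      by have := ordS_neq i; rewrite E eqxx.
    by have := ordS2_neq i; rewrite E eqxx.
  + by apply/eqP => /(edge_var_inj (prism_edge_q _) (prism_edge_pq _))[][].
  + by apply/eqP => /(edge_var_inj (prism_edge_q _) (prism_edge_pq _))[][].
- move=> v; rewrite !inE => /or3P[]/eqP->.
  1-3: by rewrite incidence_edge ?prism_edge_q ?prism_edge_pq // !inE eqxx ?orbT.
move=> v; case: (varP v) => [a ap|j|j|j]; rewrite !inE => vs; right.
- by rewrite incidence_diag; case: eqP ap => // <-; rewrite codom_f.
- rewrite incidence_edge ?prism_edge_pq // !inE /=; case: eqP => [[E]|_] //=.
  by rewrite -E eqxx !orbT in vs.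
- by rewrite incidence_edge ?prism_edge_p // !inE.
rewrite incidence_edge ?prism_edge_q // !inE.
case: eqP => [[E]|_] /=; first by rewrite -E eqxx in vs.
by case: eqP => [E|_] //; rewrite -(ordS_inj (inr_inj E)) eqxx !orbT in vs.
Qed.

Lemma kernel_diag a : a \notin codom p -> z (pair_var (a, a)) = 0.
Proof.
move=> ap; have := z_ker (true, a); rewrite (bigD1 (pair_var (a, a))) //=.
rewrite incidence_diag eqxx mulr1 big1 ?addr0 // => v.
case: (varP v) => [b _ neq|i _|i _|i _].
  rewrite incidence_diag; have [E|_] := eqVneq a b; last by rewrite mulr0.
  by rewrite E eqxx in neq.
all: by rewrite incidence_edge_off ?mulr0 ?prism_edge_p ?prism_edge_q ?prism_edge_pq.
Qed.

End KernelVector.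

Lemma ordS_iter_alternating (f : 'I_k -> int) i r :
  (forall j : nat, (j < r)%N -> f (iter j.+1 succ i) = - f (iter j succ i)) ->
  forall j : nat, (j <= r)%N -> f (iter j succ i) = if odd j then - f i else f i.
Proof.
move=> f_alt; elim=> // j IH jr; rewrite [LHS](f_alt j jr) IH 1?ltnW //=.
by case: (odd j); rewrite ?opprK.
Qed.

(** This is where C must be odd: once around, f changes sign. *)
Lemma alternating_eq0 (f : 'I_k -> int) :
  (forall i, f (ordS i) = - f i) -> forall i, f i = 0.
Proof.
move=> f_alt i; have := @ordS_iter_alternating f i k (fun _ _ => f_alt _) k (leqnn k).
by rewrite ordS_iter_period k_odd; lia.
Qed.

(** Subtracting the balance equations at p_(i+1) and q_(i+1) eliminates the edge
    {p_(i+1), q_(i+1)} and leaves an alternating function on the cycle. *)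
Lemma kernel_pq_eq z : kernel z -> forall i, z (edge_q i) = z (edge_p i).
Proof.
move=> kz i; apply/eqP; rewrite -subr_eq0; apply/eqP.
apply: (alternating_eq0 (f := fun i => z (edge_q i) - z (edge_p i))) => j.
have := kernel_p kz j; have := kernel_q kz j; lia.
Qed.

Lemma kernel_eq0 z : kernel z -> (forall i, z (edge_p i) = 0) -> forall v, z v = 0.
Proof.
move=> kz z0 v; case: (varP v) => [a|i|i|i]; rewrite ?kernel_pq_eq //.
  exact: kernel_diag.
by have := kernel_p kz (ord_pred i); rewrite ord_predK !z0; lia.
Qed.

(** * The cycle ideal is the toric ideal of the prism *)

Local Notation mnm := 'X_{1..#|{: cycle_var p}|}.
Local Notation I := (@in_cycle_ideal K n k p).
Local Notation poly := {mpoly K[#|{: cycle_var p}|]}.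

Lemma cycle_edge_is_var (a b : 'I_n) :
  cycle_edge p a b -> is_cycle_var p (a, b) /\ is_cycle_var p (b, a).
Proof.
move=> /existsP ab; rewrite /is_cycle_var /=; split; apply/orP; right; apply/existsP.
  by case: ab => i; exists i.
by case: ab => i; exists i; rewrite orbC.
Qed.

Lemma edge_binomialE (a b : 'I_n) : cycle_edge p a b ->
  edge_binomial K p a b =
    'X_[U_(pair_var (a, a)) + U_(pair_var (b, b))]
    - 'X_[U_(pair_var (a, b)) + U_(pair_var (b, a))].
Proof.
move=> /cycle_edge_is_var[ab_var ba_var].
by rewrite /edge_binomial !xvarE ?diag_var_subproof // !mpolyXD.
Qed.

Lemma in_cycle_ideal_balanced (f : poly) : I f -> balanced incidence f.
Proof.
apply: in_ideal_gen_balanced => _ [a [b [lt_ab ab ->]]].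
exists (U_(pair_var (a, a)) + U_(pair_var (b, b)))%MM.
exists (U_(pair_var (a, b)) + U_(pair_var (b, a)))%MM.
split; last exact: edge_binomialE.
have [ab_var ba_var] := cycle_edge_is_var ab.
apply/ffunP => -[h c]; rewrite !toric_degreeD !deg_mnm1 !incidence_diag.
rewrite /incidence !pair_varK //= !inE ltnW // leqNgt lt_ab /=.
have : ~~ ((c == a) && (c == b)).
  by apply/andP => -[/eqP-> /eqP E]; rewrite E ltnn in lt_ab.
by case: h => /=; do 2!case: (c == _).
Qed.

Lemma in_cycle_ideal_square i :
  I ('X_[U_(edge_pq i) + U_(edge_pq (ordS i))] - 'X_[U_(edge_p i) + U_(edge_q i)]).
Proof.
rewrite /edge_p /edge_q /edge_var /=.
have edge : cycle_edge p (p i) (p (ordS i)) by apply/existsP; exists i; rewrite eqxx.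
case: ltngtP => [lt_ii|lt_ii|/val_inj/p_inj E].
- rewrite -edge_binomialE //; apply: in_ideal_gen_mem.
  by exists (p i), (p (ordS i)).
- rewrite addmC -edge_binomialE; last first.
    by apply/existsP; exists i; rewrite eqxx orbT.
  apply: in_ideal_gen_mem; exists (p (ordS i)), (p i); split=> //.
  by apply/existsP; exists i; rewrite eqxx orbT.
by have := ordS_neq i; rewrite -E eqxx.
Qed.

Lemma in_cycle_ideal_trans (u v w : mnm) :
  I ('X_[u] - 'X_[v]) -> I ('X_[v] - 'X_[w]) -> I ('X_[u] - 'X_[w]).
Proof.
move=> uv vw; have -> : 'X_[u] - 'X_[w] = 'X_[u] - 'X_[v] + ('X_[v] - 'X_[w]) :> poly.
  by rewrite addrA subrK.
exact: in_ideal_genD.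
Qed.

Lemma in_cycle_ideal_sym (u v : mnm) : I ('X_[u] - 'X_[v]) -> I ('X_[v] - 'X_[u]).
Proof. by move=> uv; rewrite -opprB -mulN1r; apply: in_ideal_genM. Qed.

(** Termination measure for rewriting x_ab x_ba into x_aa x_bb. *)
Definition offdiag (u : mnm) : nat :=
  (\sum_(v : var | (pair_of v).1 != (pair_of v).2) u v)%N.

Lemma in_cycle_ideal_reduce (u : mnm) :
  (exists u', [/\ (offdiag u' < offdiag u)%N, deg u' = deg u & I ('X_[u] - 'X_[u'])])
  \/ (forall i, u (edge_p i) = 0%N \/ u (edge_q i) = 0%N).
Proof.
case: (boolP [forall i, (u (edge_p i) == 0%N) || (u (edge_q i) == 0%N)]).
  by move/forallP=> u0; right=> i; case/orP: (u0 i) => /eqP; auto.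
rewrite negb_forall => /existsP[i]; rewrite negb_or => /andP[up uq]; left.
pose d := (U_(edge_pq i) + U_(edge_pq (ordS i)))%MM : mnm.
pose e := (U_(edge_p i) + U_(edge_q i))%MM : mnm.
have p_neq_q : edge_p i != edge_q i.
  by apply/eqP => /(edge_var_inj (prism_edge_p _) (prism_edge_q _))[][].
have eu : (e <= u)%MM.
  apply/mnm_lepP => v; rewrite mnmDE !mnm1E.
  have [Ep|_] := eqVneq (edge_p i) v; have [Eq|_] := eqVneq (edge_q i) v => //=.
  - by rewrite Ep Eq eqxx in p_neq_q.
  - by rewrite -Ep lt0n.
  - by rewrite -Eq lt0n.
have de : I ('X_[e] - 'X_[d]) := in_cycle_ideal_sym (in_cycle_ideal_square i).
have offD (x y : mnm) : offdiag (x + y)%MM = (offdiag x + offdiag y)%N.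
  by rewrite /offdiag -big_split; apply: eq_bigr => v _; rewrite mnmDE.
have off1 v : offdiag U_(v)%MM = ((pair_of v).1 != (pair_of v).2).
  rewrite /offdiag; case: (boolP (_ != _)) => [v_off|v_diag].
    rewrite (bigD1 v) //= mnm1E eqxx big1 // => w /andP[_ wv].
    by rewrite mnm1E eq_sym (negPf wv).
  rewrite big1 // => w w_off; rewrite mnm1E; case: eqVneq => // E.
  by rewrite E w_off in v_diag.
rewrite -(submK eu); set r := (u - e)%MM; exists (r + d)%MM; split.
- rewrite !offD !off1 ltn_add2l !pair_of_edge_var
    ?prism_edge_pq ?prism_edge_p ?prism_edge_q //=.
  have neq : (p i != p (ordS i)) && (p (ordS i) != p i).
    by rewrite ![_ == p i]eq_sym andbb (inj_eq p_inj) eq_sym ordS_neq.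
  by case/andP: neq => neq1 neq2; case: (p i < _)%N => /=; rewrite !eqxx neq1 neq2.
- rewrite ![(r + _)%MM]addmC; apply: toric_degree_addr.
  exact/esym/balanced_monomialB_deg/in_cycle_ideal_balanced/de.
have -> : 'X_[r + e] - 'X_[r + d] = 'X_[r] * ('X_[e] - 'X_[d]) :> poly.
  by rewrite mulrBr -!mpolyXD.
exact: in_ideal_genM.
Qed.

(** Once no product x_ab x_ba divides them, two monomials of the same degree
    agree on both copies of the cycle, since the differences of the exponents
    of x_ab and x_ba agree by [kernel_pq_eq]; hence they are equal. *)
Lemma in_cycle_ideal_binomial (u v : mnm) : deg u = deg v -> I ('X_[u] - 'X_[v]).
Proof.
have [r] := ubnP (offdiag u + offdiag v)%N; elim: r u v => // r IH u v uv_lt uv.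
have [[u' [u'u du' uu']]|u0] := in_cycle_ideal_reduce u.
  by apply: (in_cycle_ideal_trans uu'); apply: IH; rewrite ?du' //; lia.
have [[v' [v'v dv' vv']]|v0] := in_cycle_ideal_reduce v.
  apply: (in_cycle_ideal_trans _ (in_cycle_ideal_sym vv')).
  by apply: IH; rewrite ?dv' //; lia.
suff -> : u = v by rewrite subrr; apply: in_ideal_gen0.
have uvk := kernel_deg uv; apply/mnmP => w; apply/eqP; rewrite -eqz_nat -subr_eq0.
apply/eqP; apply: (kernel_eq0 uvk) => i; have := kernel_pq_eq uvk i.
by case: (u0 i); case: (v0 i); lia.
Qed.

(** * Binomials of even closed walks *)

Section Walks.
Variable x0 : vertex.
Implicit Type w : seq vertex.

(** Positions are taken modulo the length, so that the successor of the last
    node is the first one; x0 is a default that is never read on a nonempty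
    walk. *)
Definition walk_node w (r : nat) : vertex := nth x0 w (r %% size w).
Definition walk_edge w (r : nat) : var := edge_var (walk_node w r) (walk_node w r.+1).
Definition even_part w : mnm := (\sum_(r < (size w)./2) U_(walk_edge w r.*2))%MM.
Definition odd_part w : mnm := (\sum_(r < (size w)./2) U_(walk_edge w r.*2.+1))%MM.

Lemma walk_node_small w r : (r < size w)%N -> walk_node w r = nth x0 w r.
Proof. by move=> rw; rewrite /walk_node modn_small. Qed.

Lemma walk_node_size w : walk_node w (size w) = walk_node w 0.
Proof. by rewrite /walk_node modnn mod0n. Qed.

Lemma nth_rot1 w r : (r < size w)%N -> nth x0 (rot 1 w) r = walk_node w r.+1.
Proof.
case: w => // x s; rewrite rot1_cons nth_rcons /= ltnS leq_eqVlt => /predU1P[->|rs].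
  by rewrite ltnn eqxx -[(size s).+1]/(size (x :: s)) walk_node_size.
by rewrite rs walk_node_small.
Qed.

Lemma closed_walkP w :
  closed_walk w <->
  forall r : nat, (r < size w)%N ->
    prism_edge (walk_node w r) (walk_node w r.+1).
Proof.
case: w => [|x s]; first by split.
have nodeE r : (r < size (x :: s))%N ->
    nth x0 (x :: rcons s x) r = walk_node (x :: s) r /\
    nth x0 (rcons s x) r = walk_node (x :: s) r.+1.
  move=> rs; rewrite -nth_rot1 // rot1_cons walk_node_small // -rcons_cons nth_rcons.
  by rewrite rs.
split=> [/(pathP x0) w_path r rw|w_edge].
  by have [<- <-] := nodeE r rw; apply: w_path; rewrite size_rcons.
apply/(pathP x0) => r; rewrite size_rcons => rw.
by have [-> ->] := nodeE r rw; apply: w_edge.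
Qed.

Lemma nth_walk_vars w r : (r < size w)%N ->
  (walk_vars K p w)`_r = xvar K p (prism_edge_index p (walk_node w r) (walk_node w r.+1)).
Proof.
move=> rw; have size_zip : size (zip w (rot 1 w)) = size w.
  by rewrite size_zip size_rot minnn.
rewrite (nth_map (x0, x0)) ?size_zip // nth_zip ?size_rot //=.
by rewrite nth_rot1 // (walk_node_small rw).
Qed.

Lemma even_index_lt w (r : 'I_(size w)./2) : (r.*2.+1 < size w)%N.
Proof. have := ltn_ord r; lia. Qed.

Lemma walk_binomialE w : closed_walk w ->
  walk_binomial K p w = 'X_[even_part w] - 'X_[odd_part w].
Proof.
move=> /closed_walkP w_edge; rewrite /walk_binomial /even_part /odd_part.
have varE r : (r < size w)%N -> (walk_vars K p w)`_r = 'X_(walk_edge w r).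
  by move=> rw; rewrite nth_walk_vars // xvarE // prism_edge_index_var // w_edge.
rewrite -!mprodXE; congr (_ - _); apply: eq_bigr => r _; rewrite varE //.
  exact: ltnW (even_index_lt r).
exact: even_index_lt.
Qed.

Lemma sum_parity (F : nat -> nat) h :
  (\sum_(r < h) (F r.*2 + F r.*2.+1) = \sum_(r < h.*2) F r)%N.
Proof.
elim: h => [|h IH]; first by rewrite !big_ord0.
by rewrite doubleS !big_ord_recr /= IH addnA.
Qed.

Lemma deg_sum_mnm1 h (F : 'I_h -> var) c :
  deg (\sum_(r < h) U_(F r))%MM c = (\sum_(r < h) incidence (F r) c)%N.
Proof.
rewrite (big_morph (fun u : mnm => deg u c) (id1 := 0%N) (op1 := addn)).
- by apply: eq_bigr => r _; rewrite deg_mnm1.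
- by move=> u v; rewrite toric_degreeD.
by rewrite ffunE big1 // => v _; rewrite mnm0E.
Qed.

(** Each visit of a vertex uses one edge of even and one edge of odd position. *)
Lemma closed_walk_deg w : ~~ odd (size w) -> closed_walk w ->
  deg (even_part w) = deg (odd_part w).
Proof.
move=> w_even /closed_walkP w_edge; have sizeE : (size w)./2.*2 = size w by lia.
have lt1 (r : 'I_(size w)./2) : (r.*2 < size w)%N := ltnW (even_index_lt r).
apply/ffunP => -[h c]; rewrite !deg_sum_mnm1.
have [/codomP[i ->]|c_off] := boolP (c \in codom p); last first.
  by rewrite !big1 // => r _; rewrite incidence_edge_off // w_edge // even_index_lt.
pose t : vertex := if h then inl i else inr i.
have -> : (h, p i) = vertex_label t by rewrite /t; case: (h).
pose F r : nat := t == walk_node w r.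
have incE r : (r < size w)%N ->
    incidence (walk_edge w r) (vertex_label t) = (F r + F r.+1)%N.
  move=> rw; rewrite incidence_edge ?w_edge // !inE /F.
  have := prism_edge_neq (w_edge r rw);
  case: (eqVneq t (walk_node w r)) => [->|_ _]; last by case: (t == _).
  by move/negPf->.
under eq_bigr do rewrite incE //; rewrite sum_parity sizeE.
under [RHS]eq_bigr => r _ do rewrite incE ?even_index_lt //.
rewrite (sum_parity (fun r => F r.+1)) sizeE.
case: (size w) (walk_node_size w) => [|N] FN; first by rewrite !big_ord0.
by rewrite big_ord_recl big_ord_recr /= /F FN addnC.
Qed.

Lemma even_partE w v :
  even_part w v = (\sum_(r < (size w)./2) (walk_edge w r.*2 == v))%N.
Proof. by rewrite mnm_sumE; apply: eq_bigr => r _; rewrite mnm1E. Qed.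

Lemma odd_partE w v :
  odd_part w v = (\sum_(r < (size w)./2) (walk_edge w r.*2.+1 == v))%N.
Proof. by rewrite mnm_sumE; apply: eq_bigr => r _; rewrite mnm1E. Qed.

Lemma mdeg_even_part w : mdeg (even_part w) = (size w)./2.
Proof.
rewrite mdeg_sum; under eq_bigr do rewrite mdeg1.
by rewrite sum1_card card_ord.
Qed.

Lemma mdeg_odd_part w : mdeg (odd_part w) = (size w)./2.
Proof.
rewrite mdeg_sum; under eq_bigr do rewrite mdeg1.
by rewrite sum1_card card_ord.
Qed.

Lemma sum_indicator_gt0 h (F : 'I_h -> var) v :
  (\sum_(r < h) (F r == v) != 0)%N -> exists r, v = F r.
Proof.
rewrite sum_nat_eq0 negb_forall => /existsP[r].
by case: (eqVneq (F r) v) => [<- _|_]; [exists r | rewrite implybT].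
Qed.

Lemma sum_indicator_inj h (F : 'I_h -> var) v : injective F ->
  (\sum_(r < h) (F r == v) <= 1)%N.
Proof.
move=> F_inj; case: (pickP (fun r => F r == v)) => [r /eqP<-|F0].
  by rewrite (bigD1 r) //= eqxx big1 // => s sr; rewrite (inj_eq F_inj) (negPf sr).
by rewrite big1 // => r _; rewrite F0.
Qed.

Lemma even_part_supp w v : even_part w v != 0%N ->
  exists r, [/\ (r < size w)%N, ~~ odd r & v = walk_edge w r].
Proof.
rewrite even_partE => /sum_indicator_gt0[r ->]; exists r.*2.
by rewrite odd_double ltnW // even_index_lt.
Qed.

Lemma odd_part_supp w v : odd_part w v != 0%N ->
  exists r, [/\ (r < size w)%N, odd r & v = walk_edge w r].
Proof.
rewrite odd_partE => /sum_indicator_gt0[r ->]; exists r.*2.+1.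
by rewrite /= odd_double even_index_lt.
Qed.

(** The multiple t is read off on the first edge, which occurs once, in even
    position: subtracting t times the vector of the walk leaves a kernel vector
    that vanishes there, hence everywhere. *)
Lemma walk_circuit w : (0 < size w)%N -> ~~ odd (size w) -> closed_walk w ->
  (forall r s, (r < size w)%N -> (s < size w)%N ->
     walk_edge w r = walk_edge w s -> odd r = odd s) ->
  (forall r, (r < size w)%N -> walk_edge w r = walk_edge w 0 -> r = 0%N) ->
  (forall z, kernel z ->
     (forall v, (forall r, (r < size w)%N -> v <> walk_edge w r) -> z v = 0) ->
     z (walk_edge w 0) = 0 -> forall v, z v = 0) ->
  circuit_pair incidence (even_part w) (odd_part w).
Proof.
move=> w_gt0 w_even w_closed parity first_edge ker0.
have half_gt0 : (0 < (size w)./2)%N by lia.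
have uv := closed_walk_deg w_even w_closed.
have disj v : even_part w v = 0%N \/ odd_part w v = 0%N.
  have [|/even_part_supp[r [rw r_even Er]]] := eqVneq (even_part w v) 0%N; auto.
  have [|/odd_part_supp[s [sw s_odd Es]]] := eqVneq (odd_part w v) 0%N; auto.
  by have := parity r s rw sw; rewrite -Er -Es s_odd (negPf r_even) => /(_ erefl).
have even0 : even_part w (walk_edge w 0) = 1%N.
  rewrite even_partE; case E: (size w)./2 half_gt0 => [//|h] _.
  rewrite big_ord_recl /= eqxx big1 // => r _; case: eqP => // /first_edge r0.
  have rw : ((bump 0 r).*2 < size w)%N by rewrite /bump; have := ltn_ord r; lia.
  by have := r0 rw.
have odd0 : odd_part w (walk_edge w 0) = 0%N.
  by case: (disj (walk_edge w 0)); rewrite ?even0.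
split=> // [|u' v' u'v' supp].
  by apply/eqP => E; move: even0; rewrite E odd0.
pose t := (u' (walk_edge w 0))%:Z - (v' (walk_edge w 0))%:Z; exists t => v.
apply/eqP; rewrite -subr_eq0; apply/eqP.
apply: (ker0 (fun v : var =>
  ((u' v)%:Z - (v' v)%:Z) - t * ((even_part w v)%:Z - (odd_part w v)%:Z))).
- exact: kernel_lin (kernel_deg u'v') (kernel_deg uv).
- move=> {}v v_off.
  have Ev : even_part w v = 0%N.
    by apply: contraTeq isT => /even_part_supp[r [rw _ /v_off]]; case.
  have Ov : odd_part w v = 0%N.
    by apply: contraTeq isT => /odd_part_supp[r [rw _ /v_off]]; case.
  by have [-> ->] := supp v Ev Ov; rewrite Ev Ov; ring.
by rewrite even0 odd0 subr0 mulr1 subrr.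
Qed.

(** * Even cycles and pairs of odd cycles are circuits *)

Lemma succ_modn r N : (r < N)%N -> (r.+1 %% N = if r.+1 == N then 0 else r.+1)%N.
Proof.
by move=> rN; case: eqP => [->|/eqP neq]; rewrite ?modnn // modn_small // ltn_neqAle neq.
Qed.

Lemma walk_node_inj w r s : (0 < size w)%N -> uniq w ->
  walk_node w r = walk_node w s -> r = s %[mod size w].
Proof.
move=> w_gt0 w_uniq /eqP; rewrite nth_uniq ?ltn_mod //.
by move/eqP.
Qed.

Lemma even_cycle_edge w r : even_cycle w -> (r < size w)%N ->
  prism_edge (walk_node w r) (walk_node w r.+1).
Proof. by case/and4P=> _ _ _ /closed_walkP; apply. Qed.

Lemma even_cycle_edge_inj w r s : even_cycle w -> (r < size w)%N -> (s < size w)%N ->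
  walk_edge w r = walk_edge w s -> r = s.
Proof.
move=> w_cyc rw sw; case/and4P: (w_cyc) => w_ge3 _ w_uniq _.
have w_gt0 : (0 < size w)%N by lia.
move=> /(edge_var_inj (even_cycle_edge w_cyc rw) (even_cycle_edge w_cyc sw)).
case=> -[/(walk_node_inj w_gt0 w_uniq) E1 /(walk_node_inj w_gt0 w_uniq) E2].
  by move: E1; rewrite !modn_small.
move: E1 E2; rewrite !succ_modn // !modn_small //.
by do 2!case: eqP; lia.
Qed.

(** At each vertex of the cycle only two edges of the cycle meet, so balance
    makes z change sign from one edge to the next. *)
Lemma even_cycle_kernel w z : even_cycle w -> kernel z ->
  (forall v, (forall r, (r < size w)%N -> v <> walk_edge w r) -> z v = 0) ->
  z (walk_edge w 0) = 0 -> forall v, z v = 0.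
Proof.
move=> w_cyc kz z_off z0; case/and4P: (w_cyc) => w_ge3 _ w_uniq _.
have w_gt0 : (0 < size w)%N by lia.
have onP v : (exists2 r, (r < size w)%N & v = walk_edge w r) \/ z v = 0.
  case: (boolP (v \in [seq walk_edge w r | r <- iota 0 (size w)])) => [/mapP[r]|v_off].
    by rewrite mem_iota => /andP[_ rw] ->; left; exists r.
  right; apply: z_off => r rw Ev; case/negP: v_off; rewrite Ev.
  by apply: map_f; rewrite mem_iota.
have z_step r : (r.+1 < size w)%N -> z (walk_edge w r) + z (walk_edge w r.+1) = 0.
  move=> r1w; have rw : (r < size w)%N := ltnW r1w.
  have := @kernel_vertex z kz (walk_node w r.+1) [:: walk_edge w r; walk_edge w r.+1].
  rewrite !big_cons big_nil addr0; apply.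
  - rewrite /= inE andbT; apply/eqP => /(even_cycle_edge_inj w_cyc rw r1w); lia.
  - move=> v; rewrite !inE => /orP[]/eqP->.
    1-2: by rewrite /walk_edge incidence_edge ?even_cycle_edge // !inE eqxx ?orbT.
  move=> v; rewrite !inE negb_or => /andP[/eqP v_r /eqP v_r1].
  have [[s sw Ev]|] := onP v; [right | by left].
  rewrite Ev /walk_edge incidence_edge ?even_cycle_edge // !inE; case: eqP => [|_].
    move/(walk_node_inj w_gt0 w_uniq); rewrite !modn_small // => E.
    by case: v_r1; rewrite Ev E.
  case: eqP => // /(walk_node_inj w_gt0 w_uniq).
  rewrite modn_small // succ_modn //; case: eqP => // _ [E].
  by case: v_r; rewrite Ev E.
have z_walk r : (r < size w)%N -> z (walk_edge w r) = 0.
  elim: r => // r IH rw; have := z_step r rw; rewrite IH ?add0r //; exact: ltnW.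
by move=> v; have [[r rw ->]|//] := onP v; apply: z_walk.
Qed.

Lemma even_cycle_circuit w : even_cycle w ->
  circuit_pair incidence (even_part w) (odd_part w).
Proof.
move=> w_cyc; case/and4P: (w_cyc) => w_ge3 w_even _ w_closed.
apply: walk_circuit => //; first by lia.
- by move=> r s rw sw /(even_cycle_edge_inj w_cyc rw sw) ->.
- move=> r rw; apply: (even_cycle_edge_inj w_cyc rw); lia.
move=> z; exact: even_cycle_kernel.
Qed.

Lemma edge_p_inj : injective edge_p.
Proof.
move=> i j /(edge_var_inj (prism_edge_p _) (prism_edge_p _))[].
  by case=> E _; apply: inl_inj E.
case=> Ei Ej; have := ordS2_neq j.
by rewrite -(inl_inj Ei) (inl_inj Ej) eqxx.
Qed.

Lemma edge_q_inj : injective edge_q.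
Proof.
move=> i j /(edge_var_inj (prism_edge_q _) (prism_edge_q _))[].
  by case=> E _; apply: inr_inj E.
case=> Ei Ej; have := ordS2_neq j.
by rewrite -(inr_inj Ei) (inr_inj Ej) eqxx.
Qed.

Lemma edge_p_neq_q i j : edge_p i <> edge_q j.
Proof. by move/(edge_var_inj (prism_edge_p _) (prism_edge_q _)); case=> -[]. Qed.

Lemma edge_p_neq_pq i j : edge_p i <> edge_pq j.
Proof. by move/(edge_var_inj (prism_edge_p _) (prism_edge_pq _)); case=> -[]. Qed.

Lemma edge_q_neq_pq i j : edge_q i <> edge_pq j.
Proof. by move/(edge_var_inj (prism_edge_q _) (prism_edge_pq _)); case=> -[]. Qed.

Lemma edge_pq_inj : injective edge_pq.
Proof. by move=> i j /(edge_var_inj (prism_edge_pq _) (prism_edge_pq _))[[[]]|[]]. Qed.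

Section TwoCycles.
Variable i : 'I_k.
Local Notation w := (two_cycle_walk i).
Local Notation it r := (iter r succ i).

Lemma size_two_cycle_walk : size w = k.*2.+2.
Proof. by rewrite size_cat !size_map size_traject; lia. Qed.

Lemma two_cycle_node r : (r < k.*2.+2)%N ->
  walk_node w r = if (r <= k)%N then inl (it r) else inr (it (r - k.+1)).
Proof.
move=> rw; rewrite walk_node_small ?size_two_cycle_walk // nth_cat.
rewrite size_map size_traject ltnS.
case: leqP => rk; rewrite (nth_map i) ?size_traject ?nth_traject //; lia.
Qed.

Lemma two_cycle_node_last : walk_node w k.*2.+2 = inl i.
Proof. by rewrite -size_two_cycle_walk walk_node_size two_cycle_node. Qed.

Lemma two_cycle_edgeE r : (r < k.*2.+2)%N ->
  walk_edge w r = if (r < k)%N then edge_p (it r)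
                  else if (r == k) || (r == k.*2.+1) then edge_pq i
                  else edge_q (it (r - k.+1)).
Proof.
move=> rw; rewrite /walk_edge two_cycle_node //.
have [-> | r_neq] := eqVneq r k.*2.+1.
  rewrite two_cycle_node_last.
  have -> : (k.*2.+1 <= k)%N = false by lia.
  have -> : (k.*2.+1 < k)%N = false by lia.
  have -> : (k.*2.+1 - k.+1 = k)%N by lia.
  rewrite orbT ordS_iter_period [RHS]edge_varC //; exact: prism_edge_pq.
rewrite two_cycle_node ?orbF; last by lia.
case: (ltngtP r k) => rk.
- by [].
- by have -> : (r.+1 - k.+1 = (r - k.+1).+1)%N by lia.
by rewrite rk subnn ordS_iter_period.
Qed.

Lemma two_cycle_closed : closed_walk w.
Proof.
apply/closed_walkP => r; rewrite size_two_cycle_walk => rw.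
rewrite two_cycle_node //.
have [-> | r_neq] := eqVneq r k.*2.+1.
  rewrite two_cycle_node_last.
  have -> : (k.*2.+1 <= k)%N = false by lia.
  have -> : (k.*2.+1 - k.+1 = k)%N by lia.
  by rewrite ordS_iter_period /= eqxx.
rewrite two_cycle_node; last by lia.
case: (ltngtP r k) => rk /=.
- by rewrite eqxx.
- have -> : (r.+1 - k.+1 = (r - k.+1).+1)%N by lia.
  by rewrite iterS eqxx.
by rewrite rk subnn ordS_iter_period.
Qed.

Lemma two_cycle_edge_inj r s : (r < k.*2.+2)%N -> (s < k.*2.+2)%N ->
  walk_edge w r = walk_edge w s ->
  r = s \/ (r == k) || (r == k.*2.+1) /\ (s == k) || (s == k.*2.+1).
Proof.
move=> rw sw; rewrite !two_cycle_edgeE //.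
case: ltnP => rk; case: ltnP => sk.
- by move/edge_p_inj/(ordS_iter_inj rk sk); left.
- by case: ifP => _; [move/edge_p_neq_pq | move/edge_p_neq_q].
- by case: ifP => _ /esym; [move/edge_p_neq_pq | move/edge_p_neq_q].
case: ifP => r_pq; case: ifP => s_pq; first by right.
- by move/esym/edge_q_neq_pq.
- by move/edge_q_neq_pq.
move/edge_q_inj => E; left; have : (r - k.+1 = s - k.+1)%N.
  by apply: ordS_iter_inj E; lia.
by lia.
Qed.

(** Balance at the vertices of C other than p_i makes z alternate along C, so z
    vanishes on C, and a kernel vector is determined by its values on C. *)
Lemma two_cycle_kernel z : kernel z ->
  (forall v, (forall r, (r < size w)%N -> v <> walk_edge w r) -> z v = 0) ->
  z (walk_edge w 0) = 0 -> forall v, z v = 0.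
Proof.
move=> kz z_off; rewrite two_cycle_edgeE // (_ : (0 < k)%N); last by lia.
move=> z0; apply: (kernel_eq0 kz) => j; have [r rk ->] := ordS_iter_onto i j.
elim: r rk => // r IH rk; have := kernel_p kz (it r); rewrite IH 1?ltnW //.
rewrite (z_off (edge_pq _)) ?addr0 // => s; rewrite size_two_cycle_walk => sw.
rewrite two_cycle_edgeE //; case: ifP => _; first by move/esym/edge_p_neq_pq.
case: ifP => _; last by move/esym/edge_q_neq_pq.
by move/edge_pq_inj/(@ordS_iter_inj _ i r.+1 0)=> E; have := E rk; lia.
Qed.

Lemma two_cycle_circuit : circuit_pair incidence (even_part w) (odd_part w).
Proof.
apply: walk_circuit; rewrite ?size_two_cycle_walk //.
- by rewrite /= odd_double.
- exact: two_cycle_closed.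
- move=> r s rw sw /(two_cycle_edge_inj rw sw)[->//|[r_pq s_pq]].
  by move: r_pq s_pq k_odd; lia.
- move=> r rw /(two_cycle_edge_inj rw)[]//; lia.
by rewrite -size_two_cycle_walk; apply: two_cycle_kernel.
Qed.

End TwoCycles.

(** * Conformal walks below a kernel vector *)

Section RunWalk.
Variables (i : 'I_k) (L : nat).
Hypotheses (L_gt0 : (0 < L)%N) (L_lt : (L < k)%N).
Local Notation it r := (iter r succ i).

(** The boundary of a ladder of L squares: along C from p_i, across, and back
    along C' to q_i. *)
Definition ladder_walk : seq vertex :=
  mkseq (fun r => if (r <= L)%N then inl (it r) else inr (it (L.*2.+1 - r))) L.*2.+2.

Lemma size_ladder_walk : size ladder_walk = L.*2.+2.
Proof. exact: size_mkseq. Qed.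

Lemma ladder_node r : (r < L.*2.+2)%N ->
  walk_node ladder_walk r = if (r <= L)%N then inl (it r) else inr (it (L.*2.+1 - r)).
Proof. by move=> rw; rewrite walk_node_small ?size_ladder_walk // nth_mkseq. Qed.

Lemma ladder_node_last : walk_node ladder_walk L.*2.+2 = inl i.
Proof. by rewrite -size_ladder_walk walk_node_size ladder_node. Qed.

Lemma ladder_even_cycle : even_cycle ladder_walk.
Proof.
apply/and4P; rewrite size_ladder_walk; split.
- by move: L_gt0; lia.
- by rewrite /= odd_double.
- rewrite map_inj_in_uniq ?iota_uniq // => r s; rewrite !mem_iota /= !add0n => rw sw.
  case: leqP => rL; case: leqP => sL //.
    by move=> E; apply: ordS_iter_inj (inl_inj E); lia.
  move=> E; have : (L.*2.+1 - r = L.*2.+1 - s)%N.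
    by apply: ordS_iter_inj (inr_inj E); lia.
  by lia.
apply/closed_walkP => r; rewrite size_ladder_walk => rw.
rewrite ladder_node //; have [-> | r_neq] := eqVneq r L.*2.+1.
  rewrite ladder_node_last (_ : (L.*2.+1 <= L)%N = false) ?subnn; last by lia.
  exact: eqxx.
rewrite ladder_node; last by lia.
case: (ltngtP r L) => rL /=.
- by rewrite eqxx.
- have -> : (L.*2.+1 - r = (L.*2.+1 - r.+1).+1)%N by lia.
  by rewrite iterS eqxx orbT.
have -> : (L.*2.+1 - r.+1 = L)%N by lia.
by rewrite rL.
Qed.

Lemma ladder_edgeE r : (r < L.*2.+2)%N ->
  walk_edge ladder_walk r =
    if (r < L)%N then edge_p (it r) else if r == L then edge_pq (it L)
    else if r == L.*2.+1 then edge_pq i else edge_q (it (L.*2 - r)).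
Proof.
move=> rw; rewrite /walk_edge ladder_node //; have [-> | r_neq] := eqVneq r L.*2.+1.
  rewrite ladder_node_last (_ : (L.*2.+1 <= L)%N = false) ?subnn; last by lia.
  rewrite (_ : (L.*2.+1 < L)%N = false); last by lia.
  rewrite (_ : (L.*2.+1 == L)%N = false); last by lia.
  by rewrite [RHS]edge_varC //; exact: prism_edge_pq.
rewrite ladder_node; last by lia.
case: (ltngtP r L) => rL //.
- have -> : (L.*2.+1 - r.+1 = L.*2 - r)%N by lia.
  have -> : (L.*2.+1 - r = (L.*2 - r).+1)%N by lia.
  by rewrite [RHS]edge_varC // prism_edge_q.
have -> : (L.*2.+1 - r.+1 = L)%N by lia.
by rewrite rL.
Qed.

End RunWalk.

(** Conformality in the sense of Graver bases, even positions of w giving the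
    positive part. *)
Definition conformal (z : var -> int) w := forall v,
  (even_part w v != 0%N -> (even_part w v)%:Z <= z v) /\
  (odd_part w v != 0%N -> (odd_part w v)%:Z <= - z v).

Lemma even_cycle_conformal z w : even_cycle w ->
  (forall r, (r < size w)%N ->
     1 <= if odd r then - z (walk_edge w r) else z (walk_edge w r)) ->
  conformal z w.
Proof.
move=> w_cyc z_sign v.
have even_inj : injective (fun r : 'I_(size w)./2 => walk_edge w r.*2).
  move=> r s; move/(even_cycle_edge_inj w_cyc).
  move/(_ (ltnW (even_index_lt r)) (ltnW (even_index_lt s))).
  by move/double_inj/val_inj.
have odd_inj : injective (fun r : 'I_(size w)./2 => walk_edge w r.*2.+1).
  move=> r s /(even_cycle_edge_inj w_cyc (even_index_lt r) (even_index_lt s)).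
  by case=> /double_inj/val_inj.
split=> [v_in|v_in].
- have : (even_part w v <= 1)%N by rewrite even_partE sum_indicator_inj.
  have [r [rw r_even Ev]] := even_part_supp v_in.
  by have := z_sign r rw; rewrite (negPf r_even) -Ev; lia.
have : (odd_part w v <= 1)%N by rewrite odd_partE (sum_indicator_inj _ odd_inj).
have [r [rw r_odd Ev]] := odd_part_supp v_in.
by have := z_sign r rw; rewrite r_odd -Ev; lia.
Qed.

(** The edge {p_i, q_i} is used twice, both times in odd position; this is why
    z must be at most -2 there. *)
Lemma two_cycle_conformal z i (w := two_cycle_walk i) :
  (forall r, (r < k.*2.+2)%N ->
     1 <= if odd r then - z (walk_edge w r) else z (walk_edge w r)) ->
  2 <= - z (edge_pq i) -> conformal z w.
Proof.
move=> z_sign z_i v; have half : (size w)./2 = k.+1.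
  by rewrite size_two_cycle_walk; lia.
split=> [v_in|v_in].
- have : (even_part w v <= 1)%N.
    rewrite even_partE; apply: sum_indicator_inj => r s.
    move/two_cycle_edge_inj; rewrite -(size_two_cycle_walk i) => E.
    case: (E (ltnW (even_index_lt r)) (ltnW (even_index_lt s))) => [E'|].
      exact/val_inj/double_inj.
    by case=> rE _; exfalso; move: rE k_odd; lia.
  have [r [+ r_even Ev]] := even_part_supp v_in; rewrite size_two_cycle_walk => rw.
  by have := z_sign r rw; rewrite (negPf r_even) -/w -Ev; lia.
have v_le : (odd_part w v <= 1 + (edge_pq i == v))%N.
  rewrite odd_partE half big_ord_recr /=; apply: leq_add.
    apply: sum_indicator_inj => r s /two_cycle_edge_inj E.
    have rk := ltn_ord r; have sk := ltn_ord s.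
    case: E => [||[/double_inj/val_inj//]|[rE sE]]; try lia.
    by apply: ord_inj; lia.
  rewrite /w two_cycle_edgeE ?eqxx ?orbT //.
  by rewrite (_ : (k.*2.+1 < k)%N = false) //; lia.
have [r [+ r_odd Ev]] := odd_part_supp v_in; rewrite size_two_cycle_walk => rw.
have := z_sign r rw; rewrite r_odd -/w -Ev.
by case: eqP v_le => [<-|_] /=; lia.
Qed.

Definition circuit_walk w := even_cycle w \/ exists i, w = two_cycle_walk i.

(** The run of alternating values +M, -M, ... starting at edge i of C has some
    length L <= k.  On its two ends the edges {p,q} carry the opposite of the
    sum of a value of the run and of a value of absolute value at most M that
    does not cancel it, so z has there the sign required by the ladder.  If
    L = k, both ends are at p_i and oddness of k gives the value -2M. *)
Lemma conformal_positive z i : kernel z -> 0 < z (edge_p i) ->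
  (forall j, `|z (edge_p j)| <= z (edge_p i)) ->
  z (edge_p (ord_pred i)) != - z (edge_p i) ->
  exists2 w, circuit_walk w & conformal z w.
Proof.
move=> kz z_gt0 z_max z_start; set M := z (edge_p i) in z_gt0 z_max z_start.
pose it r := iter r succ i.
pose stop r := (0 < r)%N && (z (edge_p (it r)) != - z (edge_p (it r.-1))).
have it_last : it k.-1 = ord_pred i.
  apply: ordS_inj; rewrite ord_predK -[LHS]/(it k.-1.+1) prednK ?(ltn_trans _ k_ge3) //.
  exact: ordS_iter_period.
have stop_k : stop k.
  rewrite /stop it_last /it ordS_iter_period -/M; apply/andP; split; first by lia.
  by apply: contraNneq z_start => ->; rewrite opprK.
(* L = k is always a candidate: the run cannot continue past its start. *)
have [L /andP[L_gt0 L_stop] L_min] := ex_minnP (ex_intro stop k stop_k).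
have L_le : (L <= k)%N := L_min k stop_k.
have z_it r : (r < L)%N -> z (edge_p (it r)) = if odd r then - M else M.
  move=> rL; apply: (@ordS_iter_alternating (fun j => z (edge_p j)) i L.-1); last by lia.
  move=> s sL; apply/eqP; apply: contraTT sL => sL; rewrite -leqNgt.
  by have := L_min s.+1; rewrite /stop sL => /(_ isT); lia.
have z_it_q r : (r < L)%N -> z (edge_q (it r)) = if odd r then - M else M.
  by rewrite kernel_pq_eq //; apply: z_it.
have z_pq : z (edge_pq i) <= -1.
  have := kernel_p kz (ord_pred i); rewrite ord_predK -/M.
  by have := z_max (ord_pred i); lia.
have z_pqL : 1 <= if odd L then - z (edge_pq (it L)) else z (edge_pq (it L)).
  have := kernel_p kz (it L.-1); rewrite -[ordS _]/(it L.-1.+1) prednK //.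
  have := z_it L.-1; rewrite ltn_predL => /(_ L_gt0) z_pred.
  have := L_stop; rewrite z_pred; have := z_max (it L).
  have -> : odd L.-1 = ~~ odd L by lia.
  by case: (odd L) => /=; lia.
move: L_le; rewrite leq_eqVlt => /predU1P[Lk|L_lt]; last first.
  exists (ladder_walk i L); first by left; apply: ladder_even_cycle.
  apply: even_cycle_conformal; first exact: ladder_even_cycle.
  move=> r; rewrite size_ladder_walk => rw; rewrite ladder_edgeE //.
  case: ltngtP => rL; first by rewrite z_it //; case: (odd r); lia.
    case: eqVneq => [->|r_neq]; first by rewrite /= odd_double /=; lia.
    rewrite z_it_q; last by lia.
    have -> : odd (L.*2 - r) = odd r by lia.
    by case: (odd r); lia.
  by rewrite rL.
exists (two_cycle_walk i); first by right; exists i.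
have z_pq2 : 2 <= - z (edge_pq i).
  have := kernel_p kz (ord_pred i); rewrite ord_predK -/M -it_last z_it; last by lia.
  by rewrite (_ : odd k.-1 = false); lia.
apply: two_cycle_conformal => // r rw; rewrite two_cycle_edgeE //.
case: ltnP => rk; first by rewrite z_it ?Lk //; case: (odd r); lia.
case: (boolP ((r == k) || (r == k.*2.+1))) => r_pq.
  by rewrite (_ : odd r); lia.
rewrite z_it_q; last by lia.
have -> : odd (r - k.+1) = odd r by lia.
by case: (odd r); lia.
Qed.

(** If no edge of maximal absolute value could start a run, every edge would be
    maximal and opposite to its predecessor, against [alternating_eq0]. *)
Lemma conformal_exists z v : kernel z -> z v != 0 ->
  exists2 w, circuit_walk w & conformal z w \/ conformal (fun v : var => - z v) w.
Proof.
move=> kz zv.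
have [i0 zi0] : exists i, z (edge_p i) != 0.
  apply/existsP; apply: contraNT zv; rewrite negb_exists => /forallP z0.
  by apply/eqP/kernel_eq0 => // i; apply/eqP; have := z0 i; rewrite negbK.
pose f i := `|z (edge_p i)|%N.
have [im _ im_max] := @arg_maxnP _ i0 predT f isT.
have [i fi z_start] : exists2 i, f i = f im & z (edge_p (ord_pred i)) != - z (edge_p i).
  case: (boolP [exists i, (f i == f im) && (z (edge_p (ord_pred i)) != - z (edge_p i))]).
    by case/existsP=> i /andP[/eqP fi z_start]; exists i.
  rewrite negb_exists => /forallP no_start.
  have step i : f i = f im -> z (edge_p (ord_pred i)) = - z (edge_p i).
    by move=> fi; apply/eqP; have := no_start i; rewrite fi eqxx negbK.
  (* Maximality propagates backwards along the whole cycle. *)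
  have back r : forall j, f (iter r succ j) = f im -> f j = f im.
    elim: r => // r IH j; rewrite iterSr => /IH fSj.
    by have := step _ fSj; rewrite ordSK -fSj /f => ->; rewrite abszN.
  have f_const j : f j = f im.
    by have [r _ Eim] := ordS_iter_onto j im; apply: (back r); rewrite -Eim.
  case/eqP: zi0; apply: (alternating_eq0 (f := fun j => z (edge_p j))) => j.
  by have := step (ordS j) (f_const _); rewrite ordSK => ->; rewrite opprK.
have fi_max j : (f j <= f i)%N by rewrite fi; apply: im_max.
have zi : z (edge_p i) != 0.
  by have := fi_max i0; move: zi0; rewrite /f; lia.
have z_max j : `|z (edge_p j)| <= `|z (edge_p i)| by have := fi_max j; rewrite /f; lia.
case: (ltrP 0 (z (edge_p i))) => [z_gt0|z_le0].
  have [|w w_good zw] := conformal_positive kz z_gt0 _ z_start.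
    by move=> j; have := z_max j; lia.
  by exists w; auto.
have knz : kernel (fun v : var => - z v).
  by move=> c; under eq_bigr do rewrite mulNr; rewrite sumrN kz oppr0.
have [|||w w_good zw] := conformal_positive (i := i) knz.
- by lia.
- by move=> j; have := z_max j; lia.
- by rewrite opprK eqr_oppLR.
by exists w; auto.
Qed.

Lemma circuit_walk_circuit w : circuit_walk w ->
  circuit_pair incidence (even_part w) (odd_part w).
Proof. by case=> [/even_cycle_circuit|[i ->]] //; apply: two_cycle_circuit. Qed.

Lemma circuit_walk_binomial w : circuit_walk w ->
  walk_binomial K p w = 'X_[even_part w] - 'X_[odd_part w].
Proof.
case=> [/and4P[_ _ _]|[i ->]]; first exact: walk_binomialE.
exact/walk_binomialE/two_cycle_closed.
Qed.

Lemma circuit_walk_size w : circuit_walk w -> (size w <= k.*2.+2)%N.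
Proof.
case=> [/and4P[_ _ w_uniq _]|[i ->]]; last by rewrite size_two_cycle_walk.
have := max_card (mem w); rewrite (card_uniqP w_uniq) card_sum card_ord; lia.
Qed.

Lemma primitive_pair_walk (u v : mnm) : deg u = deg v -> u != v ->
  primitive_pair incidence u v ->
  exists2 w, circuit_walk w &
    u = even_part w /\ v = odd_part w \/ u = odd_part w /\ v = even_part w.
Proof.
move=> uv neq prim.
have [a za] : exists a : var, (u a)%:Z - (v a)%:Z != 0.
  apply/existsP; apply: contraNT neq; rewrite negb_exists => /forallP uv0.
  by apply/eqP/mnmP => a; have := uv0 a; lia.
have [w w_good w_conf] := conformal_exists (kernel_deg uv) za.
have [eo eo_neq _ _] := circuit_walk_circuit w_good; exists w => //.
case: w_conf => conf; [left|right].
  have [||-> ->//] := prim _ _ eo eo_neq;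
    apply/mnm_lepP => b; have [eb ob] := conf b; lia.
rewrite eq_sym in eo_neq.
have [||-> ->//] := prim _ _ (esym eo) eo_neq;
  apply/mnm_lepP => b; have [eb ob] := conf b; lia.
Qed.

Lemma primitive_pair_bounded (u v : mnm) : deg u = deg v -> u != v ->
  primitive_pair incidence u v -> (mdeg u <= k.+1)%N /\ (mdeg v <= k.+1)%N.
Proof.
move=> uv neq prim; have [w /circuit_walk_size w_size] := primitive_pair_walk uv neq prim.
by case=> -[-> ->]; rewrite mdeg_even_part mdeg_odd_part; lia.
Qed.

Lemma universal_groebner_basis_walk (B : poly) :
  binomial_poly B -> universal_groebner_basis I B ->
  exists2 w, circuit_walk w & B = walk_binomial K p w \/ B = - walk_binomial K p w.
Proof.
move=> B2 B_ugb; have [u [v [EB uv prim]]] :=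
  universal_groebner_basis_primitive incidence_gt0 in_cycle_ideal_balanced
    in_cycle_ideal_binomial B2 B_ugb.
have neq : u != v by apply: contraTneq B2 => E; rewrite EB E subrr /binomial_poly msupp0.
have [w w_good Ew] := primitive_pair_walk uv neq prim; exists w => //.
rewrite EB circuit_walk_binomial //.
by case: Ew => -[-> ->]; [left | right; rewrite opprB].
Qed.

Lemma walk_universal_groebner_basis w : circuit_walk w ->
  universal_groebner_basis I (walk_binomial K p w)
  \/ universal_groebner_basis I (- walk_binomial K p w).
Proof.
move=> w_good; rewrite circuit_walk_binomial // opprB.
apply: (circuit_universal_groebner_basis incidence_gt0 in_cycle_ideal_balanced
  in_cycle_ideal_binomial primitive_pair_bounded).
exact: circuit_walk_circuit.
Qed.

End Walks.
End Prism.

(** * The universal Groebner basis of the cycle ideal *)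

Theorem proposition3p14 (K : fieldType) (n k : nat) (e : rel 'I_n)
    (p : 'I_k -> 'I_n) (B : {mpoly K[#|{: cycle_var p}|]})
    (G_simple : simple_graph e) (C_cycle : graph_cycle e p) (C_odd : odd k)
    (B_binomial : binomial_poly B) (B_in : in_cycle_ideal B) :
  up_to_sign (universal_groebner_basis (@in_cycle_ideal K n k p)) B <->
  up_to_sign (fun B' => exists w : seq (prism_vertex k),
    (even_cycle w \/ exists i : 'I_k, w = two_cycle_walk i) /\
    B' = walk_binomial K p w) B.
Proof.
case: C_cycle => k_ge3 p_inj _.
have k_gt0 : (0 < k)%N by case: (k) k_ge3.
pose x0 : prism_vertex k := inl (Ordinal k_gt0).
split=> [B_ugb|B_walk].
  have [w w_good Bw] : exists2 w, circuit_walk w &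
      B = walk_binomial K p w \/ B = - walk_binomial K p w.
    case: B_ugb => B_ugb.
      exact: (universal_groebner_basis_walk p_inj k_ge3 C_odd x0).
    have NB2 : binomial_poly (- B) by rewrite /binomial_poly (perm_size (msuppN B)).
    have [w w_good Bw] := universal_groebner_basis_walk p_inj k_ge3 C_odd x0 NB2 B_ugb.
    by exists w => //; case: Bw => [<-|/oppr_inj]; [right; rewrite opprK | left].
  by case: Bw => EB; [left | right]; exists w; rewrite EB ?opprK.
have [w [w_good [EB|EB]]] : exists w, circuit_walk w /\
    (B = walk_binomial K p w \/ B = - walk_binomial K p w).
- by case: B_walk => -[w [w_good EB]]; exists w; split=> //;
    [left | right; rewrite -EB opprK].
- by rewrite EB; apply: (walk_universal_groebner_basis K p_inj k_ge3 C_odd x0 w_good).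
rewrite EB /up_to_sign opprK or_comm.
exact: (walk_universal_groebner_basis K p_inj k_ge3 C_odd x0 w_good).
Qed.
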